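(* There is no convex polytope $P \subset \mathbb{R}^3$, with $o \in \operatorname{int}(P)$, such that for some $0 \leq \lambda < 1$ and $\mu > 0$, $\mu P$ is a sublevel set of $G_{P,\lambda}$. Equivalently, there is no convex polytope $P \subset \mathbb{R}^3$ such that an illumination body of $P$ is a positive homothetic copy of $P$.
   Context: $o$ denotes the origin, $\operatorname{int}$ the interior, $\operatorname{conv}$ the convex hull, and $\operatorname{vol}_n$ the $n$-dimensional volume. A convex body is a compact, convex set with nonempty interior. For a convex body $K \subset \mathbb{R}^n$ with $o \in \operatorname{int}(K)$ and $\lambda \in [0,1)$, the $\lambda$-homothetic convex hull function $G_{K,\lambda} : \mathbb{R}^n \to \mathbb{R}$ associated to $K$ is $G_{K,\lambda}(t) = \operatorname{vol}_n \operatorname{conv}(K \cup (\lambda K + t))$. A sublevel set of a function $f : \mathbb{R}^n \to \mathbb{R}$ is a set of the form $\{t \in \mathbb{R}^n : f(t) \leq c\}$ with $c \in \mathbb{R}$. For a convex body $K \subset \mathbb{R}^n$ and $\delta > 0$, the convex body $K^\delta = \{x \in \mathbb{R}^n : \operatorname{vol}_n \operatorname{conv}(K \cup \{x\}) \leq \operatorname{vol}_n(K) + \delta\}$ is called an illumination body associated to $K$. A positive homothetic copy of $P$ is a set of the form $x + \mu P$ with $x \in \mathbb{R}^3$ and $\mu > 0$.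
   Formalization: In the first claim the sublevel set {G_{P,λ} ≤ c} is taken only at levels c > vol(P), because at c = vol(P) it always equals (1−λ)P, so the claim as stated is false; for c < vol(P) it is empty. *)

(* Defs.v *)
From HB Require Import structures.
From mathcomp Require Import all_boot all_order all_algebra.
From mathcomp Require Import all_classical all_reals all_analysis.
Import Order.TTheory GRing.Theory Num.Theory.
Import numFieldNormedType.Exports.

Set Implicit Arguments.
Unset Strict Implicit.
Unset Printing Implicit Defensive.

Local Open Scope classical_set_scope.
Local Open Scope ring_scope.

Section HomotheticHull.
Context {R : realType}.
Implicit Types (K A : set 'rV[R]_3).

Definition convex_hull A : set 'rV[R]_3 := smallest (@convex_set R 'rV[R]_3) A.

(* Lower-dimensional polytopes (and [set0]) are allowed here, so a convex body
   is obtained only with the extra hypothesis of nonempty interior. *)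
Definition convex_polytope K : Prop :=
  exists2 V : set 'rV[R]_3, finite_set V & K = convex_hull V.

Definition coords3 (x : 'rV[R]_3) : R * R * R :=
  (x 0 0, x 0 1, x 0 2).

(* Three-dimensional Lebesgue measure, transported from [R * R * R]. It is
   made real-valued by [fine] and is only meant for bounded Borel sets (here,
   compact ones), on which the measure is finite. *)
Definition vol3 A : R :=
  fine (((@lebesgue_measure R \x @lebesgue_measure R) \x @lebesgue_measure R)%E
          (coords3 @` A)).

Definition scale (m : R) A : set 'rV[R]_3 := [set m *: x | x in A].

Definition translate A (t : 'rV[R]_3) : set 'rV[R]_3 := [set x + t | x in A].

Definition homothetic_hull_fun K (lambda : R) (t : 'rV[R]_3) : R :=
  vol3 (convex_hull (K `|` translate (scale lambda K) t)).

(* For a convex body [K] with [interior K 0] and [0 <= lambda < 1], the minimum of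
   [homothetic_hull_fun K lambda] is [vol3 K], and its sublevel set at
   [c = vol3 K] is always [scale (1 - lambda) K]; only levels [c > vol3 K]
   give nondegenerate nonempty ones, and these are the rescaled illumination bodies
   of [K] (with [delta > 0]). *)
Definition sublevel_set (f : 'rV[R]_3 -> R) (c : R) : set 'rV[R]_3 :=
  [set t | f t <= c].

Definition illumination_body K (delta : R) : set 'rV[R]_3 :=
  [set x | vol3 (convex_hull (K `|` [set x])) <= vol3 K + delta].

Definition positive_homothetic_copy A K : Prop :=
  exists (x : 'rV[R]_3) (mu : R), 0 < mu /\ A = translate (scale mu K) x.

End HomotheticHull.

(* Main.v *)
Require Import Defs.
From HB Require Import structures.
From mathcomp Require Import all_boot all_order all_algebra.
From mathcomp Require Import all_classical all_reals all_analysis.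
From mathcomp Require Import measurable_realfun.
From mathcomp Require Import ring lra.
Import Order.TTheory GRing.Theory Num.Theory.
Import numFieldNormedType.Exports.

(** Let [P] be cut out by irredundant inequalities [f_i <= 0], where
    [f_i x = n_i . x - h_i].

    Volume. A point [x] outside [P] adds to the hull the pyramids with apex [x]
    over the facets that it sees, and the volume of the pyramid over the facet [i]
    is proportional to [f_i x]. Adding a homothetic copy of [P] of ratio [lambda]
    instead of the center [x] of the homothety only cuts the tips off these
    pyramids, at the same proportion for all of them. So both volume functions have the form
    [vol P + sum_i k_i max(0, f_i)] with all [k_i > 0] ([vol3_hull] and
    [convex_hull_homothet]), and both claims follow once a sublevel set [Q] of such
    a function, at a level above the minimum, is known not to be homothetic to [P]
    ([level_set_not_homothetic]).

    Geometry. Suppose that it is. A neighbourhood of [P] lies in [Q], so that the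
    ratio [mu] exceeds 1 and the center of the homothety is interior to [P]. Place
    it at the origin and normalize to [h_i = 1]; then [P = {n_i . x <= 1}] and
    [Q = mu P]. Let [H_i] be the plane [n_i . x = 1]. The function has a kink along
    [H_i], whereas it is constant on each facet of [Q]: hence [H_i] crosses no
    facet of [Q] in its relative interior ([crease_not_in_facet]), and every
    boundary point of [Q] on [H_i] lies on two facets of [Q].

    Cut by a generic plane through the origin and count the vertices of the polygon
    in which it meets [Q]. A facet of [Q] contains at most two of them, and each
    lies on at least two facets: there are at most as many vertices as facets of
    [Q] that are hit. On the other hand, if the disc [H_i /\ int Q] is hit, then
    in a segment whose two ends are vertices; and a vertex is on at most two
    planes [H_i], as these contain the line of the edge of [Q] through the vertex,
    and only two planes through a line that misses [P] can contain facets of [P].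
    So there are at most as many discs hit as facets of [Q] hit. Now a plane
    through the origin hits the facet [i] of [Q] if and only if it hits that of
    [P], which is part of the disc [i]. Therefore the discs hit are precisely those
    whose facet is hit ([disc_hit_facet_hit]). But a disc is larger than the facet
    of [P] inside it, so that some plane through the origin hits the disc and
    misses the facet, and it can be taken generic ([level_set_not_dilate]).

    That the hull of a finite set is given by facet inequalities in the first place
    is [polytope_facets]. *)

Set Implicit Arguments.
Unset Strict Implicit.
Unset Printing Implicit Defensive.
Local Open Scope classical_set_scope.
Local Open Scope ring_scope.

(** * Vectors in three-space *)

Section Vectors.
Context {R : realFieldType}.
Implicit Types (u v w x y z : 'rV[R]_3) (a : R).

Lemma ord3_ind (P : 'I_3 -> Prop) : P 0 -> P 1 -> P 2 -> forall k, P k.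
Proof.
move=> P0 P1 P2 [[|[|[|//]]] hk].
- by have -> : Ordinal hk = 0 by exact: val_inj.
- by have -> : Ordinal hk = 1 by exact: val_inj.
- by have -> : Ordinal hk = 2 by exact: val_inj.
Qed.

Lemma row3P u v : u 0 0 = v 0 0 -> u 0 1 = v 0 1 -> u 0 2 = v 0 2 -> u = v.
Proof.
by move=> h0 h1 h2; apply/rowP; apply: ord3_ind.
Qed.

Definition row3 (a b c : R) : 'rV[R]_3 :=
  \row_i (if i == 0 then a else if i == 1 then b else c).

Lemma row3E0 a b c : row3 a b c 0 0 = a. Proof. by rewrite mxE. Qed.
Lemma row3E1 a b c : row3 a b c 0 1 = b. Proof. by rewrite mxE. Qed.
Lemma row3E2 a b c : row3 a b c 0 2 = c. Proof. by rewrite mxE. Qed.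
Definition row3E := (row3E0, row3E1, row3E2).

Definition dot u v : R := u 0 0 * v 0 0 + u 0 1 * v 0 1 + u 0 2 * v 0 2.

Definition cross u v : 'rV[R]_3 :=
  row3 (u 0 1 * v 0 2 - u 0 2 * v 0 1) (u 0 2 * v 0 0 - u 0 0 * v 0 2)
       (u 0 0 * v 0 1 - u 0 1 * v 0 0).

Definition triple u v w : R := dot u (cross v w).

Lemma dotC u v : dot u v = dot v u. Proof. rewrite /dot; ring. Qed.
Lemma dotDr u v w : dot u (v + w) = dot u v + dot u w.
Proof. rewrite /dot !mxE; ring. Qed.
Lemma dotZr a u v : dot u (a *: v) = a * dot u v.
Proof. rewrite /dot !mxE; ring. Qed.
Lemma dotNr u v : dot u (- v) = - dot u v.
Proof. rewrite /dot !mxE; ring. Qed.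
Lemma dot0r u : dot u 0 = 0. Proof. rewrite /dot !mxE; ring. Qed.
Lemma dotDl u v w : dot (v + w) u = dot v u + dot w u.
Proof. by rewrite !(dotC _ u) dotDr. Qed.
Lemma dotZl a u v : dot (a *: v) u = a * dot v u.
Proof. by rewrite !(dotC _ u) dotZr. Qed.
Lemma dotNl u v : dot (- v) u = - dot v u.
Proof. by rewrite !(dotC _ u) dotNr. Qed.
Lemma dot0l u : dot 0 u = 0. Proof. by rewrite dotC dot0r. Qed.
Definition dotE := (dotDr, dotDl, dotNr, dotNl, dotZr, dotZl, dot0r, dot0l).

Lemma dotvv_ge0 u : 0 <= dot u u.
Proof. by rewrite /dot; apply: addr_ge0; [apply: addr_ge0|]; rewrite -expr2 sqr_ge0. Qed.

Lemma dotvv_eq0 u : dot u u = 0 -> u = 0.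
Proof.
move=> h; apply: row3P; rewrite !mxE; apply/eqP; rewrite -sqrf_eq0; apply/eqP;
  move: h (sqr_ge0 (u 0 0)) (sqr_ge0 (u 0 1)) (sqr_ge0 (u 0 2)); rewrite /dot !expr2; lra.
Qed.

Lemma dotvv_gt0 u : u != 0 -> 0 < dot u u.
Proof.
by move=> u0; rewrite lt_neqAle dotvv_ge0 andbT eq_sym; apply: contra u0 => /eqP/dotvv_eq0->.
Qed.

Lemma dot_cross_l u v : dot u (cross u v) = 0.
Proof. rewrite /dot /cross !row3E; ring. Qed.
Lemma dot_cross_r u v : dot v (cross u v) = 0.
Proof. rewrite /dot /cross !row3E; ring. Qed.

(** By Cramer's rule the solution of [u . y = a], [v . y = b], [w . y = c],
    multiplied by [triple u v w]; without the division it is also defined for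
    dependent normals. *)
Definition cramer u v w (a b c : R) : 'rV[R]_3 :=
  a *: cross v w + b *: cross w u + c *: cross u v.

Lemma cramerE u v w y :
  triple u v w *: y = cramer u v w (dot u y) (dot v y) (dot w y).
Proof. apply: row3P; rewrite /triple /cramer /dot /cross !mxE /= ; ring. Qed.

Lemma triple_orth u v w x :
  triple u v w != 0 -> dot u x = 0 -> dot v x = 0 -> dot w x = 0 -> x = 0.
Proof.
move=> t0 hu hv hw; have := cramerE u v w x; rewrite hu hv hw /cramer !scale0r !addr0.
by move/eqP; rewrite scaler_eq0 (negPf t0) => /eqP.
Qed.

Lemma orth_cross u v x : cross u v != 0 -> dot u x = 0 -> dot v x = 0 ->
  exists a, x = a *: cross u v.
Proof.
move=> c0 hu hv; exists (dot (cross u v) x / dot (cross u v) (cross u v)).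
have tE : triple u v (cross u v) = dot (cross u v) (cross u v).
  rewrite /triple /dot /cross !row3E; ring.
have n0 : triple u v (cross u v) != 0 by rewrite tE gt_eqF // dotvv_gt0.
apply/eqP; rewrite -subr_eq0; apply/eqP; apply: (triple_orth n0).
- by rewrite !dotE hu dot_cross_l mulr0 subr0.
- by rewrite !dotE hv dot_cross_r mulr0 subr0.
- by rewrite !dotE divfK ?subrr // -tE.
Qed.

Lemma cross_eq0 u v : u != 0 -> cross u v = 0 -> exists a, v = a *: u.
Proof.
move=> u0 c0; exists (dot u v / dot u u).
have d0 : dot u u != 0 by rewrite gt_eqF // dotvv_gt0.
have E0 := congr1 (fun x : 'rV_3 => x 0 0) c0.
have E1 := congr1 (fun x : 'rV_3 => x 0 1) c0.
have E2 := congr1 (fun x : 'rV_3 => x 0 2) c0.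
rewrite /cross !row3E !mxE in E0 E1 E2.
apply: (scalerI d0); rewrite scalerA mulrCA divff // mulr1.
apply: row3P; rewrite !mxE /dot.
- transitivity (v 0 0 * (u 0 0 * u 0 0) + u 0 1 * (u 0 1 * v 0 0) + u 0 2 * (u 0 2 * v 0 0)).
    ring.
  have -> : u 0 1 * v 0 0 = u 0 0 * v 0 1 by lra.
  have -> : u 0 2 * v 0 0 = u 0 0 * v 0 2 by lra.
  ring.
- transitivity (v 0 1 * (u 0 1 * u 0 1) + u 0 0 * (u 0 0 * v 0 1) + u 0 2 * (u 0 2 * v 0 1)).
    ring.
  have -> : u 0 0 * v 0 1 = u 0 1 * v 0 0 by lra.
  have -> : u 0 2 * v 0 1 = u 0 1 * v 0 2 by lra.
  ring.
- transitivity (v 0 2 * (u 0 2 * u 0 2) + u 0 0 * (u 0 0 * v 0 2) + u 0 1 * (u 0 1 * v 0 2)).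
    ring.
  have -> : u 0 0 * v 0 2 = u 0 2 * v 0 0 by lra.
  have -> : u 0 1 * v 0 2 = u 0 2 * v 0 1 by lra.
  ring.
Qed.

Lemma ex_orth u : exists2 d, d != 0 & dot u d = 0.
Proof.
have [/andP[/eqP h0 /eqP h1]|h] := boolP ((u 0 0 == 0) && (u 0 1 == 0)).
  exists (row3 1 0 0); last by rewrite /dot !row3E h0; ring.
  by apply/eqP => /(congr1 (fun x : 'rV_3 => x 0 0)); rewrite row3E mxE; lra.
exists (row3 (u 0 1) (- u 0 0) 0); last by rewrite /dot !row3E; ring.
apply: contra h => /eqP e.
have := congr1 (fun x : 'rV_3 => x 0 0) e; have := congr1 (fun x : 'rV_3 => x 0 1) e.
by rewrite !row3E !mxE => /eqP; rewrite oppr_eq0 => -> /= ->; rewrite eqxx.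
Qed.

Definition between x y z := exists2 s : R, 0 < s < 1 & y = (1 - s) *: x + s *: z.

(** The solutions of two independent linear equations form a line along
    [cross u v], and three distinct parameters are ordered. *)
Lemma three_on_line u v x y z c d : cross u v != 0 ->
    dot u x = c -> dot u y = c -> dot u z = c ->
    dot v x = d -> dot v y = d -> dot v z = d ->
    x != y -> y != z -> x != z ->
  [\/ between x y z, between y x z | between x z y].
Proof.
move=> c0 ux uy uz vx vy vz xy yz xz.
have [a ea] : exists a, y - x = a *: cross u v.
  by apply: orth_cross => //; rewrite !dotE ?uy ?ux ?vx ?vy subrr.
have [b eb] : exists b, z - x = b *: cross u v.
  by apply: orth_cross => //; rewrite !dotE ?uz ?ux ?vx ?vz subrr.
have {}ea : y = x + a *: cross u v by rewrite -ea addrC subrK.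
have {}eb : z = x + b *: cross u v by rewrite -eb addrC subrK.
have a0 : a != 0 by apply: contra xy => /eqP a0; rewrite ea a0 scale0r addr0.
have b0 : b != 0 by apply: contra xz => /eqP b0; rewrite eb b0 scale0r addr0.
have ab : a - b != 0.
  by rewrite subr_eq0; apply: contra yz => /eqP ab; rewrite ea eb ab.
move: (cross u v) ea eb => k -> ->.
have prf p q r (n m : R) : m != 0 -> 0 < n * m -> 0 < (m - n) * m ->
    m *: q = (m - n) *: p + n *: r -> between p q r.
  move=> m0 h1 h2 e; exists (n / m).
    have m2 : 0 < m * m by rewrite lt_neqAle eq_sym mulf_neq0 //= -expr2 sqr_ge0.
    have -> : n / m = (n * m) / (m * m) by field.
    by rewrite divr_gt0 // ltr_pdivrMr // mul1r; move: h2; rewrite mulrBl subr_gt0.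
  apply: (scalerI m0); rewrite e scalerDr !scalerA; congr (_ *: _ + _ *: _); field => //.
(* with [x] as the origin of the line, [y] and [z] have the parameters [a] and [b] *)
have [ab0|ab0] := ltrP 0 (a * b).
  have [lt|ge] := ltrP 0 ((b - a) * b).
    apply: Or31; apply: (prf _ _ _ a b) => //.
    by apply: row3P; rewrite !mxE; ring.
  apply: Or33; apply: (prf _ _ _ b a) => //; first by rewrite mulrC.
    have : 0 < (a - b) * (a - b) by rewrite lt_neqAle eq_sym mulf_neq0 //= -expr2 sqr_ge0.
    lra.
  by apply: row3P; rewrite !mxE; ring.
have {}ab0 : a * b < 0 by rewrite lt_neqAle mulf_neq0.
have a2 : 0 < a * a by rewrite lt_neqAle eq_sym mulf_neq0 //= -expr2 sqr_ge0.
have b2 : 0 < b * b by rewrite lt_neqAle eq_sym mulf_neq0 //= -expr2 sqr_ge0.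
apply: Or32; apply: (prf _ _ _ (- a) (b - a)).
- by rewrite -opprB oppr_eq0.
- lra.
- lra.
- by apply: row3P; rewrite !mxE; ring.
Qed.

End Vectors.

(** * Finite systems of inequalities, and counting *)

Section PositivePart.
Context {R : realFieldType}.
Lemma max0_ge0 (x : R) : 0 <= Num.max 0 x. Proof. by rewrite le_max lexx. Qed.
Lemma max0_ge (x : R) : x <= Num.max 0 x. Proof. by rewrite le_max lexx orbT. Qed.
End PositivePart.

Section Finite.
Context {R : realFieldType} {I : finType}.

Lemma finite_eps (a b : I -> R) : (forall i, 0 < a i) ->
  exists2 e : R, 0 < e & forall i, e * `|b i| < a i.
Proof.
move=> a0; pose s := \sum_i `|b i| / a i.
have s0 : 0 <= s by apply: sumr_ge0 => i _; rewrite divr_ge0 // ltW.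
exists (1 + s)^-1 => [|i]; first by rewrite invr_gt0; lra.
rewrite mulrC ltr_pdivrMr; last lra.
rewrite mulrC -ltr_pdivrMr // /s (bigD1 i) //=.
have : 0 <= \sum_(j | j != i) `|b j| / a j by apply: sumr_ge0 => j _; rewrite divr_ge0 // ltW.
lra.
Qed.

(** The moment when a ray leaves a polyhedron: [c i] is the slack of the [i]-th
    constraint at the start, and [d i] the speed at which it is used up. *)
Lemma first_exit (c d : I -> R) j0 : (forall i, 0 <= c i) -> 0 < d j0 ->
  exists (t : R) j, [/\ 0 <= t, 0 < d j, t * d j = c j & forall i, t * d i <= c i].
Proof.
move=> c0 dj0; pose j := [arg min_(i < j0 | 0 < d i) (c i / d i)]%O.
have [dj jmin] : 0 < d j /\ forall i, 0 < d i -> c j / d j <= c i / d i.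
  by rewrite /j; case: arg_minP.
exists (c j / d j), j; split=> //; first by rewrite divr_ge0 // ltW.
  by rewrite divfK // gt_eqF.
move=> i; have [di|di] := ltrP 0 (d i).
  by rewrite -ler_pdivlMr // jmin.
by apply: le_trans (c0 i); apply: mulr_ge0_le0 => //; rewrite divr_ge0 // ltW.
Qed.

End Finite.

Lemma count_le2 (T : eqType) (p : pred T) (s : seq T) : uniq s ->
  (forall x y z, p x -> p y -> p z -> x != y -> y != z -> x != z -> False) ->
  (count p s <= 2)%N.
Proof.
move=> us h; rewrite -size_filter.
have := filter_all p s; have := filter_uniq p us.
case: (seq.filter p s) => [//|x [//|y [//|z r]]] /= /and3P[xn yn _] /and4P[px py pz _].
rewrite !inE !negb_or in xn yn; case/and3P: xn => xy xz _; case/andP: yn => yz _.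
by case: (h x y z).
Qed.

Lemma count_ge2 (T : eqType) (p : pred T) (s : seq T) x y :
  x \in s -> y \in s -> p x -> p y -> x != y -> (2 <= count p s)%N.
Proof.
move=> xs ys px py xy; rewrite -size_filter.
apply: (@uniq_leq_size _ [:: x; y]); first by rewrite /= inE xy.
by move=> z; rewrite !inE => /orP[] /eqP->; rewrite mem_filter ?px ?py.
Qed.

Lemma sum_bool_count (T : Type) (p : pred T) (s : seq T) :
  (\sum_(x <- s) p x = count p s)%N.
Proof. by rewrite -sum1_count [RHS]big_mkcond /=; apply: eq_bigr => x _; case: (p x). Qed.

(** The vectors of [Z] are treated one by one: if [w'] is orthogonal to the next
    vector [z], a multiple of [z] is added to it, small enough to preserve what has
    been achieved for the previous ones. *)
Lemma generic_perturbation (R : realFieldType) (Z : seq 'rV[R]_3) (w : 'rV[R]_3) e : 0 < e ->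
  exists w' : 'rV[R]_3, (forall k, `|w' 0 k - w 0 k| < e) /\
    forall z, z \in Z -> z != 0 -> dot w' z != 0.
Proof.
elim: Z e => [|z Z IH] e e0; first by exists w; split=> // k; rewrite subrr normr0.
have e2 : 0 < e / 2 by lra.
have [w' [near_w hZ]] := IH (e / 2) e2.
have near_w' k : `|w' 0 k - w 0 k| < e by have := near_w k; lra.
have [z0|z0] := eqVneq z 0.
  exists w'; split=> // y.
  by rewrite inE => /orP[/eqP->|yZ]; [rewrite z0 eqxx | exact: hZ].
have [wz|wz] := eqVneq (dot w' z) 0; last first.
  by exists w'; split=> // y; rewrite inE => /orP[/eqP->|yZ]; [| exact: hZ].
pose zz := [seq y <- Z | y != 0].
have zzP (i : 'I_(size zz)) : (zz`_i \in Z) && (zz`_i != 0).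
  by have := mem_nth 0 (ltn_ord i); rewrite mem_filter andbC.
have zz0 (i : 'I_(size zz)) : 0 < `|dot w' zz`_i|.
  by rewrite normr_gt0; case/andP: (zzP i); exact: hZ.
have [t1 t10 ht1] := @finite_eps R 'I_(size zz) (fun i => `|dot w' zz`_i|) (fun i => dot z zz`_i)
  zz0.
have [t2 t20 ht2] := @finite_eps R 'I_3 (fun _ => e / 2) (fun i => z 0 i) (fun _ => e2).
pose t := Num.min t1 t2.
have t0 : 0 < t by rewrite lt_min t10.
have tt1 : t <= t1 by rewrite ge_min lexx.
have tt2 : t <= t2 by rewrite ge_min lexx orbT.
exists (w' + t *: z); split=> [k|].
  rewrite !mxE addrAC; apply: le_lt_trans (ler_normD _ _) _.
  rewrite normrM (gtr0_norm t0).
  have : t * `|z 0 k| <= t2 * `|z 0 k| by rewrite ler_wpM2r.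
  have := ht2 k; have := near_w k; lra.
move=> y; rewrite inE => /orP[/eqP->|yZ] y0; rewrite !dotE.
  by rewrite wz add0r gt_eqF // mulr_gt0 // dotvv_gt0.
have yzz : y \in zz by rewrite mem_filter y0.
have yi : (index y zz < size zz)%N by rewrite index_mem.
have := ht1 (Ordinal yi); rewrite /= nth_index //.
have : t * `|dot z y| <= t1 * `|dot z y| by rewrite ler_wpM2r.
rewrite -{1}(gtr0_norm t0) -normrM => l1 l2.
apply/eqP => e1; have {e1} : t * dot z y = - dot w' y by lra.
by move=> e1; move: (le_lt_trans l1 l2); rewrite e1 normrN ltxx.
Qed.

(** Otherwise the polyhedron contains the ray from [p] in the direction [d]. *)
Lemma recession_trivial (R : realFieldType) (I : finType) (n : I -> 'rV[R]_3) (h : I -> R)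
    (M : R) (p d : 'rV[R]_3) :
  (forall p, (forall i, dot (n i) p <= h i) -> forall k, `|p 0 k| <= M) ->
  (forall i, dot (n i) p <= h i) -> (forall i, dot (n i) d <= 0) -> d = 0.
Proof.
move=> bounded Pp hd; suff d0 k : d 0 k = 0 by apply: row3P; rewrite !mxE d0.
apply/eqP; apply: contraT; rewrite -normr_gt0 => dk.
have M0 : 0 <= M by apply: le_trans (bounded _ Pp 0).
pose t := (M + M + 1) / `|d 0 k|.
have t0 : 0 <= t by rewrite divr_ge0 //; lra.
have Pt i : dot (n i) (p + t *: d) <= h i.
  by rewrite !dotE; have := mulr_ge0_le0 t0 (hd i); have := Pp i; lra.
have := bounded _ Pt k; have := bounded _ Pp k.
rewrite !mxE => h1 h2; have := ler_normB (p 0 k + t * d 0 k) (p 0 k).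
rewrite addrAC subrr add0r normrM (ger0_norm t0) /t divfK ?gt_eqF //; lra.
Qed.

(** * A generic section through the center *)

Section Normalized.
Context {R : realFieldType} {I : finType}.
Variables (n : I -> 'rV[R]_3) (q : I -> 'rV[R]_3) (kap : I -> R) (mu delta M : R).
Hypothesis qE : forall i, dot (n i) (q i) = 1.
Hypothesis q_lt : forall i j, j != i -> dot (n j) (q i) < 1.
Hypothesis bounded : forall p, (forall i, dot (n i) p <= 1) -> forall k, `|p 0 k| <= M.
Hypothesis mu1 : 1 < mu.
Hypothesis kap0 : forall i, 0 < kap i.
Let G x := \sum_i kap i * Num.max 0 (dot (n i) x - 1).
Hypothesis GQ : forall x, (G x <= delta) <-> (forall i, dot (n i) x <= mu).

Let mu0 : 0 < mu. Proof. exact: lt_trans ltr01 mu1. Qed.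

Let recession d : d != 0 -> exists j, 0 < dot (n j) d.
Proof.
move=> d0; apply/existsP; apply: contraT => /existsPn h.
have hd i : dot (n i) d <= 0 by rewrite leNgt h.
have P0 i : dot (n i) 0 <= 1 by rewrite dot0r ler01.
by move/eqP: (recession_trivial bounded P0 hd); rewrite (negPf d0).
Qed.

Let n_neq0 i : n i != 0.
Proof. by apply/eqP => h; have := qE i; rewrite h dot0l; lra. Qed.

Let n_inj i j : n i = n j -> i = j.
Proof.
move=> h; apply/eqP; apply: contraT; rewrite eq_sym => ij.
by have := q_lt ij; rewrite -h qE ltxx.
Qed.

Let parallel_eq i j y c : c != 0 -> dot (n i) y = c -> dot (n j) y = c ->
  cross (n i) (n j) = 0 -> i = j.
Proof.
move=> c0 hi hj /(cross_eq0 (n_neq0 i))[a e]; apply: n_inj.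
move: hj; rewrite e dotZl hi => /(congr1 (fun z => z / c)).
by rewrite mulfK // divff // => ->; rewrite scale1r.
Qed.

(** On the ray from the center through [y], the function exceeds [delta] right
    after [y], and it is Lipschitz there. *)
Let G_boundary y j : (forall i, dot (n i) y <= mu) -> dot (n j) y = mu -> G y = delta.
Proof.
move=> Qy tj; apply: le_anti; rewrite (iffRL (GQ y)) //= leNgt; apply/negP => lt.
pose C := \sum_i kap i * `|dot (n i) y|.
have C0 : 0 <= C by apply: sumr_ge0 => i _; rewrite mulr_ge0 // ltW.
pose e := (delta - G y) / (C + 1).
have e0 : 0 < e by rewrite divr_gt0; lra.
have : G ((1 + e) *: y) <= delta.
  have : G ((1 + e) *: y) <= G y + e * C.
    rewrite /G /C mulr_sumr -big_split /=; apply: ler_sum => i _.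
    rewrite mulrCA -mulrDr ler_pM2l // dotZr.
    have h1 : e * dot (n i) y <= e * `|dot (n i) y| by rewrite ler_pM2l // ler_norm.
    have h2 : 0 <= e * `|dot (n i) y| by rewrite mulr_ge0 // ltW.
    have := max0_ge0 (dot (n i) y - 1); have := max0_ge (dot (n i) y - 1).
    by rewrite ge_max; move=> *; apply/andP; split; lra.
  have : e * (C + 1) = delta - G y by rewrite /e divfK // gt_eqF //; lra.
  lra.
move/GQ => /(_ j); rewrite dotZr tj.
have : 0 < e * mu by rewrite mulr_gt0.
lra.
Qed.

(** If [j] were the only facet of the level set at [x], the function would be
    constant near [x] in the plane of that facet; but its [k]-th summand has a kink
    along the facet plane of [k], and all others are convex. *)
Let crease_not_in_facet x k j : dot (n k) x = 1 -> (forall i, dot (n i) x <= mu) ->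
  dot (n j) x = mu -> exists2 j', j' != j & dot (n j') x = mu.
Proof.
move=> hk Qx hj.
have [/existsP[j' /andP[jj /eqP h]]|/existsPn no] :=
  boolP [exists j', (j' != j) && (dot (n j') x == mu)]; first by exists j'.
have lt i : i != j -> dot (n i) x < mu.
  by move=> ij; rewrite lt_neqAle Qx andbT; have := no i; rewrite ij.
have kj : cross (n k) (n j) != 0.
  apply/eqP => /(cross_eq0 (n_neq0 k))[a e].
  have am : a = mu by move: hj; rewrite e dotZl hk mulr1.
  have kj : j != k by apply/eqP => jk; move: hj mu1; rewrite jk hk; lra.
  by have := q_lt kj; rewrite e dotZl qE am; move: mu1; lra.
(* [d] is parallel to the facet [j] and transversal to the plane of [k] *)
pose d := cross (cross (n k) (n j)) (n j).
have dj : dot (n j) d = 0 by exact: dot_cross_r.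
have dk : dot (n k) d != 0.
  have -> : dot (n k) d = - dot (cross (n k) (n j)) (cross (n k) (n j)).
    rewrite /d /dot /cross !row3E; ring.
  by rewrite oppr_eq0 gt_eqF // dotvv_gt0.
pose slack i := if i == j then 1 else mu - dot (n i) x.
have slack0 i : 0 < slack i by rewrite /slack; case: eqP => [//|/eqP/lt]; lra.
have [e e0 he] := finite_eps (fun i => dot (n i) d) slack0.
have side (s : R) : `|s| = e -> G (x + s *: d) = delta.
  move=> se; apply: (@G_boundary _ j); last by rewrite !dotE dj hj; lra.
  move=> i; rewrite !dotE; have [->|ij] := eqVneq i j; first by rewrite dj hj; lra.
  have := he i; rewrite /slack (negPf ij) -se -normrM.
  by have := ler_norm (s * dot (n i) d); lra.
have h1 := side e (gtr0_norm e0).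
have h2 : G (x + (- e) *: d) = delta by apply: side; rewrite normrN gtr0_norm.
have h3 := G_boundary Qx hj.
suff : G x + G x < G (x + e *: d) + G (x + (- e) *: d) by lra.
rewrite /G -!big_split /= (bigD1 k) //= [X in _ < X](bigD1 k) //=.
apply: ltr_leD; last first.
  apply: ler_sum => i _; rewrite -!mulrDr ler_pM2l // !dotE.
  set a := dot (n i) x; set b := e * dot (n i) d.
  have -> : - e * dot (n i) d = - b by rewrite mulNr.
  have := max0_ge0 (a + b - 1); have := max0_ge (a + b - 1).
  have := max0_ge0 (a - b - 1); have := max0_ge (a - b - 1).
  by case: (lerP 0 (a - 1)) => ? *; lra.
rewrite -!mulrDr ltr_pM2l // !dotE hk.
have : 0 < `|e * dot (n k) d| by rewrite normr_gt0 mulf_neq0 // gt_eqF.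
rewrite mulNr; set b := e * _ => b0.
have := max0_ge0 (1 + b - 1); have := max0_ge (1 + b - 1).
have := max0_ge0 (1 - b - 1); have := max0_ge (1 - b - 1).
rewrite subrr maxxx; move: b0; case: (ger0P b) => hb; lra.
Qed.

Section GenericPlane.
Variable w : 'rV[R]_3.
Hypothesis w0 : w != 0.
(** The plane orthogonal to [w] contains no common direction of two facet planes that
    are not parallel, and it misses the point, if there is just one, at which a facet plane of the
    polytope meets two facet planes of the level set. *)
Hypothesis w_cross : forall i j, cross (n i) (n j) != 0 -> dot w (cross (n i) (n j)) != 0.
Hypothesis w_triple : forall i j k, cramer (n i) (n j) (n k) 1 mu mu != 0 ->
  dot w (cramer (n i) (n j) (n k) 1 mu mu) != 0.

(** The facet is that of the level set; the disc is the part of the facet plane of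
    the polytope in the interior of the level set. *)
Definition facet_hit i := exists x,
  [/\ dot w x = 0, dot (n i) x = mu & forall j, dot (n j) x <= mu].
Definition disc_hit i := exists x,
  [/\ dot w x = 0, dot (n i) x = 1 & forall j, dot (n j) x < mu].

Definition is_corner y := [&& dot w y == 0, [forall j, dot (n j) y <= mu]
  & [exists j, exists k, [&& j != k, dot (n j) y == mu & dot (n k) y == mu]]].

(** The corners are among the points that Cramer's rule yields for pairs of facets,
    which makes them a finite sequence. *)
Definition corners := undup [seq y <- [seq (triple (n j) (n k) w)^-1 *:
  cramer (n j) (n k) w mu mu 0 | j <- enum I, k <- enum I] | is_corner y].

Let is_cornerP y : reflect [/\ dot w y = 0, forall j, dot (n j) y <= mu &
  exists j k, [/\ j != k, dot (n j) y = mu & dot (n k) y = mu]] (is_corner y).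
Proof.
apply: (iffP and3P) => [[/eqP h1 /forallP h2]|[/eqP h1 /forallP h2 [j [k [jk hj hk]]]]].
  by move=> /existsP[j /existsP[k /and3P[jk /eqP hj /eqP hk]]]; split=> //; exists j, k.
by split=> //; apply/existsP; exists j; apply/existsP; exists k; rewrite jk hj hk !eqxx.
Qed.

Let mu_neq0 : mu != 0. Proof. by rewrite gt_eqF. Qed.

Let mem_corners y : (y \in corners) = is_corner y.
Proof.
rewrite mem_undup mem_filter; case: is_cornerP => //= -[wy Qy [j [k [jk hj hk]]]].
apply/allpairsPdep; exists j, k; rewrite !mem_enum; split=> //=.
have t0 : triple (n j) (n k) w != 0.
  have -> : triple (n j) (n k) w = dot w (cross (n j) (n k)).
    rewrite /triple /dot /cross !row3E; ring.
  by apply: w_cross; apply: contra jk => /eqP/(parallel_eq mu_neq0 hj hk)->.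
by apply: (scalerI t0); rewrite cramerE hj hk wy scalerA divff // scale1r.
Qed.

(** A corner between two others on the facet [i] would be on a second facet [j]
    that contains these as well, so that the section plane would contain the common
    line of [i] and [j]. *)
Let corners_on_facet i : (count (fun y => dot (n i) y == mu) corners <= 2)%N.
Proof.
have key x y z : is_corner x -> is_corner y -> is_corner z ->
    dot (n i) x = mu -> dot (n i) y = mu -> dot (n i) z = mu -> x != z ->
    between x y z -> False.
  case/is_cornerP => wx Qx _ /is_cornerP[wy Qy [j0 [k0 [jk hj0 hk0]]]].
  case/is_cornerP => wz Qz _ hx hy hz xz [s /andP[s0 s1] ys].
  have [j ji hj] : exists2 j, j != i & dot (n j) y = mu.
    by have [ji|ji] := eqVneq j0 i; [exists k0; rewrite // -ji eq_sym | exists j0].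
  have ym : (1 - s) * dot (n j) x + s * dot (n j) z = mu by rewrite -hj ys !dotE.
  have hjx : dot (n j) x = mu.
    apply: le_anti; rewrite Qx /=.
    have s1' : 0 < 1 - s by lra.
    rewrite -(ler_pM2l s1'); have : s * dot (n j) z <= s * mu by rewrite ler_pM2l.
    by move: ym; lra.
  have hjz : dot (n j) z = mu.
    apply: le_anti; rewrite Qz /= -(ler_pM2l s0).
    by move: ym; rewrite hjx; lra.
  have t0 : triple (n i) (n j) w != 0.
    have -> : triple (n i) (n j) w = dot w (cross (n i) (n j)).
      rewrite /triple /dot /cross !row3E; ring.
    apply: w_cross; apply: contra ji => /eqP/(parallel_eq mu_neq0 hx hjx)->.
    by rewrite eqxx.
  have : x - z = 0 by apply: (triple_orth t0); rewrite !dotE ?hx ?hz ?hjx ?hjz ?wx ?wz subrr.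
  by move/eqP; rewrite subr_eq0 (negPf xz).
have -> : count (fun y => dot (n i) y == mu) corners =
          count (fun y => is_corner y && (dot (n i) y == mu)) corners.
  by apply: eq_in_count => y; rewrite mem_corners => ->.
apply: count_le2; first exact: undup_uniq.
move=> x y z /andP[cx /eqP hx] /andP[cy /eqP hy] /andP[cz /eqP hz] xy yz xz.
have niw : cross (n i) w != 0.
  apply/eqP => /(cross_eq0 (n_neq0 i))[a e].
  case/is_cornerP: cx => wx _ _; move: wx; rewrite e dotZl hx => /eqP.
  by rewrite mulf_eq0 (negPf mu_neq0) orbF => /eqP a0; move: w0; rewrite e a0 scale0r eqxx.
case/is_cornerP: (cx) => wx _ _; case/is_cornerP: (cy) => wy _ _; case/is_cornerP: (cz) => wz _ _.
case: (three_on_line niw hx hy hz wx wy wz xy yz xz).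
- exact: key cx cy cz hx hy hz xz.
- exact: key cy cx cz hy hx hz yz.
- exact: key cx cz cy hx hz hy xy.
Qed.

(** By genericity the facet planes of the polytope through a corner all contain
    the common line of two facets of the level set. The normals of these planes lie
    on a line, and the middle one of three would give a redundant inequality. *)
Let discs_at_corner y : y \in corners -> (count (fun i => dot (n i) y == 1%R) (enum I) <= 2)%N.
Proof.
rewrite mem_corners => /is_cornerP[wy Qy [j [k [jk hj hk]]]].
have y0 : y != 0 by apply/eqP => y0; move: hj; rewrite y0 dot0r => /esym/eqP; rewrite (negPf mu_neq0).
(* the direction of the common line of the facets [j] and [k] *)
pose d := cross (n j) (n k).
have d0 : d != 0 by apply: contra jk => /eqP/(parallel_eq mu_neq0 hj hk)->.
have dy : cross d y != 0.
  apply/eqP => /(cross_eq0 d0)[a e]; move: hj; rewrite e dotZr dot_cross_l mulr0 => /esym/eqP.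
  by rewrite (negPf mu_neq0).
have nd i : dot (n i) y = 1 -> dot d (n i) = 0.
  move=> hi; have := cramerE (n i) (n j) (n k) y; rewrite hi hj hk => e.
  have c0 : cramer (n i) (n j) (n k) 1 mu mu = 0.
    apply/eqP; apply: contraT => /w_triple; rewrite -e dotE wy mulr0 eqxx.
    by [].
  move/eqP: e; rewrite c0 scaler_eq0 (negPf y0) orbF => /eqP.
  by rewrite /triple dotC.
have key i1 i2 i3 : i1 != i2 -> i3 != i2 -> between (n i1) (n i2) (n i3) -> False.
  move=> i12 i32 [s /andP[s0 s1] e]; have := qE i2; rewrite e !dotE.
  have s1' : 0 < 1 - s by lra.
  have h1 : (1 - s) * dot (n i1) (q i2) < (1 - s) * 1 by rewrite ltr_pM2l // q_lt.
  have h3 : s * dot (n i3) (q i2) < s * 1 by rewrite ltr_pM2l // q_lt.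
  lra.
apply: count_le2 => [|i1 i2 i3 /eqP h1 /eqP h2 /eqP h3 i12 i23 i13]; first exact: enum_uniq.
have ne a b : a != b -> n a != n b by apply: contra => /eqP/n_inj->.
have [] := three_on_line dy (nd _ h1) (nd _ h2) (nd _ h3)
  (etrans (dotC _ _) h1) (etrans (dotC _ _) h2) (etrans (dotC _ _) h3)
  (ne _ _ i12) (ne _ _ i23) (ne _ _ i13).
- by apply: key => //; rewrite eq_sym.
- by apply: key; rewrite // eq_sym.
- by apply: key; rewrite // eq_sym.
Qed.

(** The section plane meets the plane of the disc in a line through [x]. Where this
    line leaves the level set, in either direction, [crease_not_in_facet] provides a
    second facet. *)
Let two_corners_on_disc i : disc_hit i -> (2 <= count (fun y => dot (n i) y == 1%R) corners)%N.
Proof.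
case=> x [wx hi Qx].
have d0 : cross (n i) w != 0.
  apply/eqP => /(cross_eq0 (n_neq0 i))[a e]; move: wx; rewrite e dotZl hi mulr1 => a0.
  by move: w0; rewrite e a0 scale0r eqxx.
have exit d : d != 0 -> dot (n i) d = 0 -> dot w d = 0 ->
    exists2 t, 0 < t & is_corner (x + t *: d) && (dot (n i) (x + t *: d) == 1).
  move=> {}d0 di dw; have [j0 hj0] := recession d0.
  have c0 j : 0 <= mu - dot (n j) x by rewrite subr_ge0 ltW.
  have [t [j [t0 hj tj tle]]] := first_exit (d := fun j => dot (n j) d) c0 hj0.
  have tgt : 0 < t.
    rewrite lt_neqAle t0 andbT; apply/eqP => t00; move: tj; rewrite -t00 mul0r.
    by have := Qx j; lra.
  exists t => //; have hi' : dot (n i) (x + t *: d) = 1 by rewrite !dotE hi di mulr0 addr0.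
  rewrite hi' eqxx andbT; apply/is_cornerP.
  have Qy j' : dot (n j') (x + t *: d) <= mu by rewrite !dotE; have := tle j'; lra.
  have hj' : dot (n j) (x + t *: d) = mu by rewrite !dotE; lra.
  split=> //; first by rewrite !dotE wx dw mulr0 addr0.
  by have [k kj hk] := crease_not_in_facet hi' Qy hj'; exists k, j.
have [t t0 /andP[ct ht]] := exit _ d0 (dot_cross_l _ _) (dot_cross_r _ _).
have [s s0 /andP[cs hs]] : exists2 t, 0 < t & is_corner (x + t *: (- cross (n i) w)) &&
    (dot (n i) (x + t *: (- cross (n i) w)) == 1).
  by apply: exit; rewrite ?oppr_eq0 // !dotE ?dot_cross_l ?dot_cross_r oppr0.
apply: (@count_ge2 _ (fun y => dot (n i) y == 1) _ _ _ _ _ ht hs); rewrite ?mem_corners //.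
apply/eqP => /addrI/eqP; rewrite scalerN -subr_eq0 opprK -scalerDl scaler_eq0 (negPf d0) orbF.
by apply/negP; rewrite gt_eqF // addr_gt0.
Qed.

(** Double counting of the corners on discs and on facets shows that there are no
    more discs hit than facets hit. Conversely a facet that is hit yields a disc
    that is hit, by contraction towards the center. *)
Lemma disc_hit_facet_hit i : disc_hit i -> facet_hit i.
Proof.
pose A := [pred i | `[< facet_hit i >]]; pose B := [pred i | `[< disc_hit i >]].
have inA j : (j \in A) = `[< facet_hit j >] by [].
have inB j : (j \in B) = `[< disc_hit j >] by [].
have AB : A \subset B.
  apply/fintype.subsetP => j; rewrite inA inB => /asboolP[x [wx hj Qx]]; apply/asboolP.
  have mi0 : 0 < mu^-1 by rewrite invr_gt0.
  exists (mu^-1 *: x); split.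
  - by rewrite dotZr wx mulr0.
  - by rewrite dotZr hj mulVf.
  - move=> k; rewrite dotZr mulrC ltr_pdivrMr //.
    apply: le_lt_trans (Qx k) _.
    have : 0 < (mu - 1) * mu by rewrite mulr_gt0 // subr_gt0.
    move: mu1; lra.
have BA : (#|B| <= #|A|)%N.
  rewrite -(@leq_pmul2r 2) //.
  apply: (@leq_trans (\sum_(y <- corners) \sum_(j in I) (dot (n j) y == 1%R))).
    rewrite exchange_big /= -sum_nat_const; apply: (@leq_trans (\sum_(j in B) \sum_(y <- corners) (dot (n j) y == 1%R))); last first.
      by rewrite [leqRHS](bigID B) /= leq_addr.
    apply: leq_sum => j; rewrite inB => /asboolP/two_corners_on_disc.
    by rewrite sum_bool_count.
  apply: (@leq_trans (\sum_(y <- corners) \sum_(j in I) (dot (n j) y == mu))).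
    rewrite big_seq [leqRHS]big_seq; apply: leq_sum => y cy.
    rewrite -!big_enum !sum_bool_count /=.
    apply: leq_trans (discs_at_corner cy) _.
    move: cy; rewrite mem_corners => /is_cornerP[_ _ [j [k [jk /eqP hj /eqP hk]]]].
    by apply: (@count_ge2 _ (fun i => dot (n i) y == mu) _ _ _ _ _ hj hk jk); rewrite mem_enum.
  rewrite exchange_big /= -sum_nat_const (bigID A) /= [X in (_ + X)%N]big1 ?addn0.
    by apply: leq_sum => j _; rewrite sum_bool_count corners_on_facet.
  move=> j /= /asboolPn nA; rewrite big_seq big1 // => y.
  rewrite mem_corners => /is_cornerP[wy Qy _].
  by case: eqP => // hj; case: nA; exists y.
have /subset_leqif_card : A \subset B by [].
move=> le; have /eqP : #|A| == #|B| by rewrite eqn_leq BA (le.1).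
move=> eAB; have := le.2; rewrite eAB eqxx => /esym/fintype.subsetP BsubA.
by move=> hi; have := BsubA i; rewrite inA inB => h; apply/asboolP/h/asboolP.
Qed.

End GenericPlane.

(** A point [y] of the disc [i0] beyond the facet plane of some [j] is separated
    from the facet [i0] by a plane through the center; a generic plane nearby hits
    the disc, between [y] and [q i0], and misses the facet. *)
Lemma level_set_not_dilate (i0 : I) : False.
Proof.
have [d d0 di] := ex_orth (n i0).
have [j0 hj0] := recession d0.
have q_le i j : dot (n j) (q i) <= 1.
  by have [->|ji] := eqVneq j i; [rewrite qE | rewrite ltW // q_lt].
have c0 j : 0 <= 1 - dot (n j) (q i0) by rewrite subr_ge0.
have [t [j [t0 jd tj tle]]] := first_exit (d := fun j => dot (n j) d) c0 hj0.
have mu10 : 0 < mu - 1 by rewrite subr_gt0.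
have [e e0 he] := finite_eps (fun i => dot (n i) d) (fun _ => mu10).
pose y := q i0 + (t + e) *: d; pose g := e * dot (n j) d.
have g0 : 0 < g by rewrite mulr_gt0.
have yi0 : dot (n i0) y = 1 by rewrite !dotE qE di mulr0 addr0.
have yj : dot (n j) y = 1 + g by rewrite !dotE /g; lra.
have ylt i : dot (n i) y < mu.
  rewrite !dotE; have := tle i; have := he i.
  have : e * dot (n i) d <= e * `|dot (n i) d| by rewrite ler_pM2l // ler_norm.
  lra.
clearbody y g; clear t t0 tj tle e e0 he jd c0 j0 hj0 mu10 d d0 di.
(* on the plane of [i0] this is [1 + g / 2 - n j], where [n j <= 1] on the facet
   and [n j = 1 + g] at [y] *)
pose w := (1 + g / 2) *: n i0 - n j.
have wE x : dot (n i0) x = 1 -> dot w x = 1 + g / 2 - dot (n j) x.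
  by move=> h; rewrite !dotE h mulr1.
have M0 : 0 <= M.
  by have := bounded (p := q i0) (q_le i0) 0; apply: le_trans; rewrite normr_ge0.
(* a bound for the coordinates of [y] and of all points of the polytope *)
pose N := M + `|y 0 0| + `|y 0 1| + `|y 0 2|.
have [y00 y10 y20] : [/\ 0 <= `|y 0 0|, 0 <= `|y 0 1| & 0 <= `|y 0 2|] by rewrite !normr_ge0.
have N0 : 0 <= N by rewrite /N; lra.
pose eps := (g / 2) / (3 * N + 1).
have eps0 : 0 < eps by rewrite divr_gt0 //; lra.
have epsN : eps * (3 * N) < g / 2.
  have : eps * (3 * N + 1) = g / 2 by rewrite /eps divfK // gt_eqF //; lra.
  by move: eps0; lra.
pose Z := [seq cross (n i) (n k) | i <- enum I, k <- enum I] ++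
  [seq cramer (n a.1) (n a.2.1) (n a.2.2) 1 mu mu | a <- enum {: I * (I * I)}].
have [w' [near_w hZ]] := generic_perturbation Z w eps0.
have closew (x : 'rV[R]_3) : (forall k, `|x 0 k| <= N) -> `|dot w' x - dot w x| < g / 2.
  move=> xN; apply: le_lt_trans epsN.
  have -> : dot w' x - dot w x = (w' 0 0 - w 0 0) * x 0 0 + (w' 0 1 - w 0 1) * x 0 1
    + (w' 0 2 - w 0 2) * x 0 2 by rewrite /dot; ring.
  have b k : `|(w' 0 k - w 0 k) * x 0 k| <= eps * N.
    by rewrite normrM ler_pM // ltW.
  apply: le_trans (ler_normD _ _) _; have := ler_normD ((w' 0 0 - w 0 0) * x 0 0) ((w' 0 1 - w 0 1) * x 0 1).
  have := b 0; have := b 1; have := b 2; lra.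
have w'F p : (forall i, dot (n i) p <= 1) -> dot (n i0) p = 1 -> 0 < dot w' p.
  move=> Pp hp; have := closew p; rewrite wE // ltr_norml.
  have := Pp j => hj close'.
  have /close'/andP[] : forall k, `|p 0 k| <= N by move=> k; have := bounded Pp k; rewrite /N; lra.
  by lra.
have w'y : dot w' y < 0.
  have /closew : forall k, `|y 0 k| <= N.
    by apply: ord3_ind; rewrite /N; move: M0; lra.
  by rewrite wE // yj ltr_norml => /andP[]; lra.
have w'q : 0 < dot w' (q i0) by apply: w'F.
have : facet_hit w' i0.
  apply: disc_hit_facet_hit.
  - by apply/eqP => w0; move: w'q; rewrite w0 dot0l ltxx.
  - move=> i k; apply: hZ; rewrite mem_cat; apply/orP; left.
    by apply/allpairsPdep; exists i, k; rewrite !mem_enum.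
  - move=> i k l; apply: hZ; rewrite mem_cat; apply/orP; right.
    by apply/mapP; exists (i, (k, l)); rewrite ?mem_enum.
  pose D := dot w' (q i0) - dot w' y.
  have D0 : 0 < D by rewrite subr_gt0 (lt_trans w'y).
  pose s := dot w' (q i0) / D.
  have s0 : 0 < s by rewrite divr_gt0.
  have s1 : s < 1 by rewrite ltr_pdivrMr // mul1r /D ltrDl oppr_gt0.
  exists ((1 - s) *: q i0 + s *: y); split.
  - have -> : dot w' ((1 - s) *: q i0 + s *: y) = dot w' (q i0) - s * D.
      by rewrite !dotE /D; ring.
    by rewrite /s divfK ?subrr // gt_eqF.
  - by rewrite !dotE qE yi0; ring.
  - move=> k; rewrite !dotE.
    have : (1 - s) * dot (n k) (q i0) < (1 - s) * mu.
      rewrite ltr_pM2l; last lra.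
      by apply: le_lt_trans (q_le _ _) mu1.
    have : s * dot (n k) y < s * mu by rewrite ltr_pM2l.
    lra.
case=> x [wx hx Qx].
have mi0 : 0 < mu^-1 by rewrite invr_gt0.
suff : 0 < dot w' (mu^-1 *: x) by rewrite dotZr wx mulr0 ltxx.
apply: w'F; last by rewrite dotZr hx mulVf // gt_eqF.
by move=> i; rewrite dotZr mulrC ler_pdivrMr // mul1r.
Qed.

End Normalized.

(** * Homothetic level sets *)
Section General.
Context {R : realFieldType} {I : finType}.
Variables (n : I -> 'rV[R]_3) (h : I -> R) (q : I -> 'rV[R]_3) (kap : I -> R).
Variables (mu delta M : R) (z p0 : 'rV[R]_3).

(** Each facet can be moved outwards within the level set. For [mu <= 1] this yields
    a direction in which the polytope is unbounded; for [1 < mu] it puts the center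
    [c] of the homothety into the interior of the polytope. *)
Theorem level_set_not_homothetic :
  (forall i, dot (n i) (q i) = h i) ->
  (forall i j, j != i -> dot (n j) (q i) < h j) ->
  (forall p, (forall i, dot (n i) p <= h i) -> forall k, `|p 0 k| <= M) ->
  (forall i, dot (n i) p0 < h i) ->
  (forall i, 0 < kap i) -> 0 < mu -> 0 < delta ->
  (forall x, \sum_i kap i * Num.max 0 (dot (n i) x - h i) <= delta <->
     exists2 p, (forall i, dot (n i) p <= h i) & x = z + mu *: p) ->
  False.
Proof.
move=> qE q_lt bounded p0P kap0 mu0 delta0 GQ.
have q_le i j : dot (n j) (q i) <= h j.
  by have [->|ji] := eqVneq j i; [rewrite qE | rewrite ltW // q_lt].
have M0 : 0 <= M.
  have := bounded _ (fun i => ltW (p0P i)) 0; apply: le_trans; exact: normr_ge0.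
have recession d : d != 0 -> exists j, 0 < dot (n j) d.
  move=> d0; apply/existsP; apply: contraT => /existsPn hn.
  have hd i : dot (n i) d <= 0 by rewrite leNgt hn.
  by move/eqP: (recession_trivial bounded (fun i => ltW (p0P i)) hd); rewrite (negPf d0).
have [i0 _] : exists j, 0 < dot (n j) (row3 1 0 0 : 'rV[R]_3).
  apply: recession; apply/eqP => /(congr1 (fun x : 'rV_3 => x 0 0)).
  by rewrite row3E mxE; lra.
have n_neq0 i : n i != 0.
  by apply/eqP => n0; have := p0P i; have := qE i; rewrite n0 !dot0l => <-; rewrite ltxx.
(* [q i + e n_i] is in the level set for small [e > 0] *)
have grow i : h i < dot (n i) z + mu * h i.
  pose C := \sum_j kap j * `|dot (n j) (n i)|.
  have [e e0 /(_ ord0) he] := finite_eps (fun _ : 'I_1 => C) (fun _ => delta0).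
  have [p Pp ep] : exists2 p, (forall j, dot (n j) p <= h j) & q i + e *: n i = z + mu *: p.
    apply/GQ; apply: le_trans (ltW he).
    have C0 : 0 <= C by apply: sumr_ge0 => j _; rewrite mulr_ge0 // ltW.
    rewrite ger0_norm // /C mulr_sumr; apply: ler_sum => j _.
    rewrite mulrCA ler_pM2l // ge_max !dotE mulr_ge0 ?(ltW e0) //=.
    have : e * dot (n j) (n i) <= e * `|dot (n j) (n i)| by rewrite ler_pM2l // ler_norm.
    by have := q_le i j; lra.
  have := congr1 (dot (n i)) ep; rewrite !dotE qE.
  have : 0 < e * dot (n i) (n i) by rewrite mulr_gt0 // dotvv_gt0.
  have : mu * dot (n i) p <= mu * h i by rewrite ler_pM2l.
  lra.
have mu1 : 1 < mu.
  rewrite ltNge; apply/negP => mu1.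
  pose d := (1 - mu) *: p0 - z.
  have dlt i : dot (n i) d < 0.
    have : (1 - mu) * dot (n i) p0 <= (1 - mu) * h i.
      by apply: ler_wpM2l; [lra | exact: ltW].
    by have := grow i; rewrite !dotE; lra.
  have [d0|d0] := eqVneq d 0; first by have := dlt i0; rewrite d0 dot0r ltxx.
  by have [j] := recession d d0; have := dlt j; lra.
(* the fixed point of [p |-> z + mu p] *)
pose c := (1 - mu)^-1 *: z.
have zc : z = (1 - mu) *: c.
  by rewrite /c scalerA divff ?scale1r // lt_eqF //; lra.
clearbody c.
pose g i := h i - dot (n i) c.
have g0 i : 0 < g i.
  have := grow i; rewrite {1}zc dotE => gr.
  have : 0 < (mu - 1) * g i by rewrite /g; lra.
  by rewrite pmulr_rgt0 //; lra.
have gN i : g i != 0 by rewrite gt_eqF.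
pose n' i := (g i)^-1 *: n i.
have n'E i x : dot (n' i) x = (g i)^-1 * dot (n i) x by rewrite dotZl.
apply: (@level_set_not_dilate R I n' (fun i => q i - c) (fun i => kap i * g i) mu delta
  (M + \sum_k `|c 0 k|)) => // [i|i j ji|p Pp k|i|x].
- by rewrite n'E dotDr dotNr qE; exact: mulVf.
- by rewrite n'E mulrC ltr_pdivrMr // mul1r /g dotDr dotNr ltrBlDr subrK q_lt.
- have : `|(p + c) 0 k| <= M.
    apply: bounded => i; have := Pp i; rewrite n'E mulrC ler_pdivrMr // mul1r dotDr /g; lra.
  rewrite mxE => h1; rewrite (bigD1 k) //=.
  have h2 : 0 <= \sum_(j | j != k) `|c 0 j| by apply: sumr_ge0.
  have := ler_normB (p 0 k + c 0 k) (c 0 k); rewrite addrK; lra.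
- by rewrite mulr_gt0.
have -> : \sum_i kap i * g i * Num.max 0 (dot (n' i) x - 1) =
          \sum_i kap i * Num.max 0 (dot (n i) (x + c) - h i).
  apply: eq_bigr => i _; rewrite -mulrA; congr (_ * _).
  rewrite maxr_pMr ?ltW // mulr0 mulrBr mulr1 n'E mulrA divff // mul1r dotE /g.
  by congr (Num.max 0 _); ring.
rewrite GQ; split=> [[p Pp e] i|Qx].
  have -> : x = z + mu *: p - c by rewrite -e addrK.
  rewrite n'E mulrC ler_pdivrMr // {1}zc !dotE /g.
  have : mu * dot (n i) p <= mu * h i by rewrite ler_pM2l.
  lra.
exists (mu^-1 *: (x + c - z)); last first.
  by rewrite scalerA divff ?scale1r ?gt_eqF // addrCA subrr addr0.
move=> i; rewrite dotZr mulrC ler_pdivrMr // zc !dotE.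
by have := Qx i; rewrite n'E mulrC ler_pdivrMr // /g; lra.
Qed.

End General.

(** * Volume in three-space *)

Section Affine1.
Context {R : realType}.
Local Notation leb := (@lebesgue_measure R).

Lemma measurable_affine1 (r b : R) :
  measurable_fun [set: measurableTypeR R] (fun c => r * c + b : measurableTypeR R).
Proof. by apply: measurable_funD => //; apply: measurable_funM. Qed.

(** Both sides are measures in [A], and they agree on intervals. *)
Lemma lebesgue_measure_affine (r b : R) (A : set (measurableTypeR R)) : 0 < r -> measurable A ->
  leb A = (r%:E * leb [set c | A (r * c + b)%R])%E.
Proof.
move=> r0 mA; pose r' := NngNum (ltW r0).
pose f := (fun c : R => (r * c + b)%R) : measurableTypeR R -> measurableTypeR R.
have mf : measurable_fun setT f by exact: measurable_affine1.
have -> : (r%:E * leb [set c | A (r * c + b)%R])%E = mscale r' (pushforward leb f) A by [].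
pose m : {measure set (measurableTypeR R) -> \bar R} := mscale r' (pushforward leb f).
apply: (@lebesgue_measure_unique R (m mf) _ A mA) => _ [[x y] _ <-].
have -> : m mf `]x, y]%classic = (r%:E * leb (`](x - b) / r, (y - b) / r]%classic)%R)%E.
  congr (_ * leb _)%E; apply/seteqP; split=> c /=; rewrite !in_itv /= ltr_pdivrMr //
    ler_pdivlMr // /f ltrBlDr lerBrDr (mulrC c) //.
rewrite !lebesgue_measure_itv /= !lte_fin ltr_pM2r ?invr_gt0 // ltrD2r.
case: ifP => _; last by rewrite mule0.
by rewrite -!EFinB -EFinM; congr (_%:E); field; rewrite gt_eqF.
Qed.
End Affine1.

Section Slices.
Local Open Scope ereal_scope.
Context d1 d2 (T1 : measurableType d1) (T2 : measurableType d2) (R : realType).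
Variable m1 : {sigma_finite_measure set T1 -> \bar R}.
Variable m2 : {sigma_finite_measure set T2 -> \bar R}.
Variables (r : R) (A B : set (T1 * T2)).
Hypotheses (r0 : (0 <= r)%R) (mA : measurable A) (mB : measurable B).

Lemma scale_xsection :
  (forall t, m2 (xsection B t) = r%:E * m2 (xsection A t)) ->
  (m1 \x m2) B = r%:E * (m1 \x m2) A.
Proof.
move=> h; rewrite /product_measure1 -ge0_integralZl_EFin //=.
- by apply: eq_integral => t _ /=; rewrite h.
- exact: measurable_fun_xsection.
Qed.

Lemma product_measure_swap C : measurable C -> (m1 \x m2) C = (m1 \x^ m2) C.
Proof.
move=> mC; pose m' : {measure set (T1 * T2) -> \bar R} := m1 \x^ m2.
apply: (@product_measure_unique _ _ _ _ _ m1 m2 m' _ C mC) => X Y mX mY.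
exact: product_measure2E.
Qed.

Lemma scale_ysection :
  (forall t, m1 (ysection B t) = r%:E * m1 (ysection A t)) ->
  (m1 \x m2) B = r%:E * (m1 \x m2) A.
Proof.
move=> h; rewrite !product_measure_swap // /product_measure2 -ge0_integralZl_EFin //=.
- by apply: eq_integral => t _ /=; rewrite h.
- exact: measurable_fun_ysection.
Qed.
End Slices.

Section TripleSlices.
Local Open Scope ereal_scope.
Context d (T : measurableType d) (R : realType).
Variable m : {sigma_finite_measure set T -> \bar R}.

(** The product measure under a name of its own, to which sigma-finiteness is
    attached. *)
Definition square_measure : set (T * T) -> \bar R := m \x m.
HB.instance Definition _ := Measure.on square_measure.

Let square_measure_sigma_finite : sigma_finite setT square_measure.
Proof.
have /sigma_finiteP[F [TF ndF Ffin]] := sigma_finiteT m.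
exists (fun k => F k `*` F k) => [|k]; last first.
  have [mF Foo] := Ffin k; split; first exact: measurableX.
  by rewrite /square_measure product_measure1E // lte_mul_pinfty // ge0_fin_numE.
apply/seteqP; split=> // -[x y] _.
have [i _ Fx] : (\bigcup_k F k) x by rewrite -TF.
have [j _ Fy] : (\bigcup_k F k) y by rewrite -TF.
exists (maxn i j) => //; split=> /=.
- exact: (subsetPset _ _ (ndF _ _ (leq_maxl i j))).
- exact: (subsetPset _ _ (ndF _ _ (leq_maxr i j))).
Qed.

HB.instance Definition _ :=
  Measure_isSigmaFinite.Build _ _ _ square_measure square_measure_sigma_finite.

Variables (r : R) (A B : set (T * T * T)).
Hypotheses (r0 : (0 <= r)%R) (mA : measurable A) (mB : measurable B).

(** Integration over one coordinate first, the two others being fixed. *)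
Lemma scale_slice0 :
  (forall c b, m (ysection (ysection B c) b) = r%:E * m (ysection (ysection A c) b)) ->
  ((m \x m) \x m) B = r%:E * ((m \x m) \x m) A.
Proof.
move=> h; apply: (@scale_ysection _ _ _ _ R square_measure m r A B r0 mA mB) => c.
apply: (@scale_ysection _ _ _ _ R m m r _ _ r0) => [||b].
- exact: measurable_ysection.
- exact: measurable_ysection.
- exact: h.
Qed.

Lemma scale_slice1 :
  (forall c a, m (xsection (ysection B c) a) = r%:E * m (xsection (ysection A c) a)) ->
  ((m \x m) \x m) B = r%:E * ((m \x m) \x m) A.
Proof.
move=> h; apply: (@scale_ysection _ _ _ _ R square_measure m r A B r0 mA mB) => c.
apply: (@scale_xsection _ _ _ _ R m m r _ _ r0) => [|a].
- exact: measurable_ysection.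
- exact: h.
Qed.

Lemma scale_slice2 :
  (forall ab, m (xsection B ab) = r%:E * m (xsection A ab)) ->
  ((m \x m) \x m) B = r%:E * ((m \x m) \x m) A.
Proof. exact: (@scale_xsection _ _ _ _ R square_measure m r A B r0 mA). Qed.

End TripleSlices.

Section Volume.
Context {R : realType}.
Local Notation leb := (@lebesgue_measure R).
Local Notation mR := (measurableTypeR R).
Local Notation T3 := (mR * mR * mR)%type.
Implicit Types (A B : set 'rV[R]_3).

Definition of_coords (u : T3) : 'rV[R]_3 := row3 u.1.1 u.1.2 u.2.

Definition vol A : \bar R := ((leb \x leb) \x leb)%E (of_coords @^-1` A).

Definition meas3 A : Prop := measurable (of_coords @^-1` A : set T3).

Lemma vol3E A : vol3 A = fine (vol A).
Proof.
rewrite /vol3 /vol; congr (fine (_ _)); apply/seteqP; split=> [_ [x Ax <-]|u Au] /=.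
  by rewrite /of_coords /coords3 /= (_ : row3 _ _ _ = x) //; apply: row3P; rewrite row3E.
exists (of_coords u) => //; rewrite /coords3 /of_coords !row3E.
by case: u {Au} => [[a b] c].
Qed.

Lemma measurable_dot (a : 'rV[R]_3) (b : R) :
  measurable_fun [set: T3] (fun u : T3 => dot a (of_coords u) + b : mR).
Proof.
rewrite /dot; under eq_fun do rewrite /of_coords !row3E.
have m1 : measurable_fun [set: T3] (fun u : T3 => u.1.1 : mR).
  exact: (measurableT_comp measurable_fst measurable_fst).
have m2 : measurable_fun [set: T3] (fun u : T3 => u.1.2 : mR).
  exact: (measurableT_comp measurable_snd measurable_fst).
have m3 : measurable_fun [set: T3] (fun u : T3 => u.2 : mR) by exact: measurable_snd.
by apply: measurable_funD => //; apply: measurable_funD; [apply: measurable_funD|];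
  apply: measurable_funM.
Qed.

Lemma meas3_gt (a : 'rV[R]_3) (b : R) : meas3 [set x | 0 < dot a x + b].
Proof.
have := measurable_dot a b measurableT (measurable_itv `]0, +oo[).
rewrite setTI /meas3 => mA; rewrite (_ : of_coords @^-1` _ =
  (fun u : T3 => dot a (of_coords u) + b : mR) @^-1` `]0, +oo[%classic) //.
by apply/seteqP; split=> u /=; rewrite in_itv /= andbT.
Qed.

Lemma meas3_ge (a : 'rV[R]_3) (b : R) : meas3 [set x | 0 <= dot a x + b].
Proof.
have := measurable_dot a b measurableT (measurable_itv `[0, +oo[).
rewrite setTI /meas3 => mA; rewrite (_ : of_coords @^-1` _ =
  (fun u : T3 => dot a (of_coords u) + b : mR) @^-1` `[0, +oo[%classic) //.
by apply/seteqP; split=> u /=; rewrite in_itv /= andbT.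
Qed.

Lemma meas3I A B : meas3 A -> meas3 B -> meas3 (A `&` B).
Proof. exact: measurableI. Qed.

Lemma meas3U A B : meas3 A -> meas3 B -> meas3 (A `|` B).
Proof. exact: measurableU. Qed.

Lemma meas3_forall (I : finType) (F : I -> set 'rV[R]_3) : (forall i, meas3 (F i)) ->
  meas3 [set x | forall i, F i x].
Proof.
move=> mF; rewrite /meas3 (_ : _ @^-1` _ = \bigcap_(i in [set: I]) (of_coords @^-1` F i)).
  by apply: fin_bigcap_measurable => [|i _]; [exact: finite_finset | exact: mF].
by apply/seteqP; split=> u /= h i; [move=> _; exact: h | exact: h].
Qed.

Lemma meas3_exists (I : finType) (F : I -> set 'rV[R]_3) : (forall i, meas3 (F i)) ->
  meas3 [set x | exists i, F i x].
Proof.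
move=> mF; rewrite /meas3 (_ : _ @^-1` _ = \bigcup_(i in [set: I]) (of_coords @^-1` F i)).
  by apply: fin_bigcup_measurable => [|i _]; [exact: finite_finset | exact: mF].
by apply/seteqP; split=> u /=; [case=> i h; exists i | case=> i _ h; exists i].
Qed.

Definition set_coord (k : 'I_3) (x : 'rV[R]_3) (c : R) : 'rV[R]_3 :=
  \row_i if i == k then c else x 0 i.

Definition slice k x A : set mR := [set c | A (set_coord k x c)].

(** Cavalieri's principle in the [k]-th coordinate direction. *)
Lemma vol_slices k (r : R) A B : 0 <= r -> meas3 A -> meas3 B ->
  (forall x, leb (slice k x B) = (r%:E * leb (slice k x A))%E) ->
  vol B = (r%:E * vol A)%E.
Proof.
move=> r0 mA mB; elim/ord3_ind: k => h.
- apply: (scale_slice0 r0 mA mB) => c b.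
  have e C : ysection (ysection (of_coords @^-1` C) c) b = slice 0 (row3 0 b c) C.
    apply/seteqP; split=> a; rewrite /ysection /= !inE /slice /=;
    by rewrite (_ : set_coord _ _ _ = of_coords (a, b, c));
      [by rewrite ?inE | by apply: row3P; rewrite !mxE].
  by rewrite !e; exact: h.
- apply: (scale_slice1 r0 mA mB) => c a.
  have e C : xsection (ysection (of_coords @^-1` C) c) a = slice 1 (row3 a 0 c) C.
    apply/seteqP; split=> b; rewrite /xsection /ysection /= !inE /slice /=;
    by rewrite (_ : set_coord _ _ _ = of_coords (a, b, c));
      [by rewrite ?inE | by apply: row3P; rewrite !mxE].
  by rewrite !e; exact: h.
- apply: (scale_slice2 r0 mA) => -[a b].
  have e C : xsection (of_coords @^-1` C) (a, b) = slice 2 (row3 a b 0) C.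
    apply/seteqP; split=> c; rewrite /xsection /= !inE /slice /=;
    by rewrite (_ : set_coord _ _ _ = of_coords (a, b, c));
      [by rewrite ?inE | by apply: row3P; rewrite !mxE].
  by rewrite !e; exact: h.
Qed.

Lemma vol0 : vol (set0 : set 'rV[R]_3) = 0%E.
Proof. by rewrite /vol preimage_set0 measure0. Qed.

Lemma vol_ge0 A : (0 <= vol A)%E.
Proof. exact: measure_ge0. Qed.

Lemma le_vol A B : meas3 A -> meas3 B -> A `<=` B -> (vol A <= vol B)%E.
Proof. by move=> mA mB AB; apply: le_measure; rewrite ?inE // => u; exact: AB. Qed.

Lemma volU A B : meas3 A -> meas3 B -> A `&` B = set0 -> vol (A `|` B) = (vol A + vol B)%E.
Proof.
by move=> mA mB AB; rewrite /vol preimage_setU measureU // -preimage_setI AB preimage_set0.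
Qed.

Lemma volU0 A B : meas3 A -> meas3 B -> vol B = 0%E -> vol (A `|` B) = vol A.
Proof. by move=> mA mB B0; rewrite /vol preimage_setU measureU0. Qed.

Lemma meas3_0 : meas3 (set0 : set 'rV[R]_3).
Proof. by rewrite /meas3 preimage_set0. Qed.

Lemma meas3_seq (I : eqType) (s : seq I) (F : I -> set 'rV[R]_3) : (forall i, meas3 (F i)) ->
  meas3 [set x | exists2 i, i \in s & F i x].
Proof.
move=> mF; elim: s => [|a s IH].
  by rewrite (_ : mkset _ = set0); [exact: meas3_0 | apply/seteqP; split=> // x []].
rewrite (_ : mkset _ = F a `|` [set x | exists2 i, i \in s & F i x]); first exact: meas3U.
apply/seteqP; split=> x /=; first by case=> i; rewrite inE => /orP[/eqP->|si] Fi; [left | right; exists i].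
by case=> [Fa|[i si Fi]]; [exists a; rewrite ?inE ?eqxx | exists i; rewrite ?inE ?si ?orbT].
Qed.

Lemma vol_disjoint_union (I : eqType) (s : seq I) (F : I -> set 'rV[R]_3) A :
  uniq s -> meas3 A -> (forall i, meas3 (F i)) ->
  (forall i, A `&` F i = set0) -> (forall i j, i != j -> F i `&` F j = set0) ->
  vol (A `|` [set x | exists2 i, i \in s & F i x]) = (vol A + \sum_(i <- s) vol (F i))%E.
Proof.
move=> + mA mF AF FF; elim: s => [|a s IH] /=.
  move=> _; rewrite big_nil adde0; congr vol.
  by apply/seteqP; split=> x /=; [case=> // -[] | left].
case/andP=> anotin us; rewrite big_cons.
rewrite (_ : _ `|` _ = (A `|` [set x | exists2 i, i \in s & F i x]) `|` F a); last first.
  apply/seteqP; split=> x /=.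
    case=> [Ax|[i]]; first by left; left.
    by rewrite inE => /orP[/eqP->|si] Fi; [right | left; right; exists i].
  case=> [[Ax|[i si Fi]]|Fa]; first by left.
    by right; exists i; rewrite // inE si orbT.
  by right; exists a; rewrite // inE eqxx.
rewrite volU ?IH //; last first.
- apply/seteqP; split=> // x /= [[Ax|[i si Fi]] Fa].
    by have : (A `&` F a) x by []; rewrite AF.
  have ia : i != a by apply: contraNneq anotin => <-.
  by have : (F i `&` F a) x by []; rewrite FF.
- by apply: meas3U => //; exact: meas3_seq.
by rewrite -addeA [(_ + vol (F a))%E]addeC.
Qed.

Lemma vol_null_union (I : eqType) (s : seq I) (F : I -> set 'rV[R]_3) :
  (forall i, meas3 (F i)) -> (forall i, vol (F i) = 0%E) ->
  vol [set x | exists2 i, i \in s & F i x] = 0%E.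
Proof.
move=> mF F0; elim: s => [|a s IH].
  by rewrite (_ : mkset _ = set0); [exact: vol0 | apply/seteqP; split=> // x []].
rewrite (_ : mkset _ = F a `|` [set x | exists2 i, i \in s & F i x]).
  by rewrite volU0 //; exact: meas3_seq.
apply/seteqP; split=> x /=; first by case=> i; rewrite inE => /orP[/eqP->|si] Fi; [left | right; exists i].
by case=> [Fa|[i si Fi]]; [exists a; rewrite ?inE ?eqxx | exists i; rewrite ?inE ?si ?orbT].
Qed.

Lemma measurable_slice k x A : meas3 A -> measurable (slice k x A).
Proof.
move=> mA; pose g (c : mR) : T3 := (set_coord k x c 0 0, set_coord k x c 0 1, set_coord k x c 0 2).
have mg : measurable_fun [set: mR] g.
  have m i : measurable_fun [set: mR] (fun c : mR => set_coord k x c 0 i : mR).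
    under eq_fun do rewrite mxE.
    by case: (i == k); [exact: measurable_id | exact: measurable_cst].
  apply: measurable_fun_pair; first exact: measurable_fun_pair.
  exact: m.
have := mg measurableT _ mA; rewrite setTI; congr measurable.
apply/seteqP; split=> c; rewrite /slice /g /=.
all: rewrite (_ : of_coords _ = set_coord k x c) //; apply: row3P; by rewrite row3E.
Qed.

(** The maps concerned change only the [k]-th coordinate, by an affine function of
    slope [r] whose constant term may depend in any way on the others. *)
Lemma vol_affine k (r : R) (b : 'rV[R]_3 -> R) A B : 0 < r -> meas3 A -> meas3 B ->
  (forall x c, A (set_coord k x c) <-> B (set_coord k x (r * c + b x))) ->
  vol B = (r%:E * vol A)%E.
Proof.
move=> r0 mA mB AB; apply: (vol_slices (k := k) (ltW r0) mA mB) => x.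
rewrite (lebesgue_measure_affine (b x) r0 (measurable_slice k x mB)).
congr (_ * leb _)%E; apply/seteqP; split=> c; rewrite /slice /=; exact: (AB x c).1 || exact: (AB x c).2.
Qed.

Lemma dot_set_coord k (a x : 'rV[R]_3) c : dot a (set_coord k x c) = dot a (set_coord k x 0) + a 0 k * c.
Proof. by elim/ord3_ind: k; rewrite /dot !mxE /=; ring. Qed.

Lemma meas3_le (a : 'rV[R]_3) (b : R) : meas3 [set x | dot a x <= b].
Proof.
have := meas3_ge (- a) b; congr meas3.
by apply/seteqP; split=> x /=; rewrite dotNl; lra.
Qed.

Lemma meas3_lt (a : 'rV[R]_3) (b : R) : meas3 [set x | dot a x < b].
Proof.
have := meas3_gt (- a) b; congr meas3.
by apply/seteqP; split=> x /=; rewrite dotNl; lra.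
Qed.

Lemma meas3_plane (a : 'rV[R]_3) (b : R) : meas3 [set x | dot a x = b].
Proof.
have := meas3I (meas3_le a b) (meas3_ge a (- b)); congr meas3.
apply/seteqP; split=> x /=; first by case=> h1 h2; apply: le_anti; rewrite h1 /=; lra.
by move=> ->; split; lra.
Qed.

(** Every line in the direction of a suitable axis meets the plane in one point. *)
Lemma vol_plane (a : 'rV[R]_3) (b : R) : a != 0 -> vol [set x | dot a x = b] = 0%E.
Proof.
move=> a0; have [k ak] : exists k, a 0 k != 0.
  apply/existsP; apply: contraNT a0 => /existsPn h; apply/eqP/row3P; rewrite mxE;
    by apply/eqP; have := h 0; have := h 1; have := h 2; rewrite !negbK.
rewrite -(mul0e (vol (set0 : set 'rV[R]_3))).
apply: (vol_slices (k := k) (lexx 0) meas3_0 (meas3_plane a b)) => x.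
rewrite mul0e (_ : slice _ _ _ = [set (b - dot a (set_coord k x 0)) / a 0 k]) ?lebesgue_measure_set1 //.
apply/seteqP; split=> c; rewrite /slice /= (dot_set_coord _ _ x c).
  by move=> <-; rewrite addrC addKr mulrC mulKf.
by move=> ->; rewrite [a 0 k * _]mulrC divfK // addrC subrK.
Qed.

Lemma box_preimage (a b : 'I_3 -> R) :
  of_coords @^-1` [set x : 'rV[R]_3 | forall k, a k <= x 0 k <= b k] =
  ((`[a 0, b 0]%classic `*` `[a 1, b 1]%classic) `*` `[a 2, b 2]%classic : set T3).
Proof.
apply/seteqP; split=> -[[u v] w] /=; rewrite !in_itv /=.
  by move=> h; have := h 0; have := h 1; have := h 2; rewrite !row3E.
by case=> -[h0 h1] h2; apply: ord3_ind; rewrite row3E.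
Qed.

Lemma meas3_box (a b : 'I_3 -> R) : meas3 [set x : 'rV[R]_3 | forall k, a k <= x 0 k <= b k].
Proof.
rewrite /meas3 box_preimage; apply: measurableX; last exact: measurable_itv.
by apply: measurableX; exact: measurable_itv.
Qed.

Lemma vol_box (a b : 'I_3 -> R) : (forall k, a k < b k) ->
  vol [set x : 'rV[R]_3 | forall k, a k <= x 0 k <= b k] =
  ((b 0 - a 0) * (b 1 - a 1) * (b 2 - a 2))%:E.
Proof.
move=> ab; rewrite /vol box_preimage.
have mi k : measurable (`[a k, b k]%classic : set mR) by exact: measurable_itv.
apply: etrans (product_measure1E _ _ (measurableX (mi 0) (mi 1)) (mi 2)) _.
apply: etrans (congr1 (fun z => z * _)%E (product_measure1E _ _ (mi 0) (mi 1))) _.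
by rewrite /= !lebesgue_measure_itv /= !lte_fin !ab -!EFinB -!EFinM.
Qed.

Lemma vol_bounded A (M : R) : meas3 A -> (forall x, A x -> forall k, `|x 0 k| <= M) ->
  (vol A < +oo)%E.
Proof.
move=> mA AM; pose N := `|M| + 1.
have N0 : - N < N by rewrite /N; have := normr_ge0 M; lra.
apply: (@le_lt_trans _ _ (vol [set x : 'rV[R]_3 | forall k : 'I_3, - N <= x 0 k <= N])).
  apply: le_vol => // [|x Ax k]; first exact: meas3_box (fun _ => - N) (fun _ => N).
  by rewrite -ler_norml; apply: le_trans (AM x Ax k) _; rewrite /N; have := ler_norm M; lra.
by rewrite (@vol_box (fun _ => - N) (fun _ => N)) // ltry.
Qed.

Lemma vol_cube_gt0 A (y : 'rV[R]_3) (e : R) : 0 < e -> meas3 A ->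
  (forall x : 'rV[R]_3, (forall k, `|x 0 k - y 0 k| <= e) -> A x) -> (0 < vol A)%E.
Proof.
move=> e0 mA Ay.
apply: (@lt_le_trans _ _ (vol [set x : 'rV[R]_3 | forall k, y 0 k - e <= x 0 k <= y 0 k + e])).
  rewrite (@vol_box (fun k => y 0 k - e) (fun k => y 0 k + e)) => [|k]; last lra.
  by rewrite lte_fin !mulr_gt0 //; lra.
apply: le_vol => // [|x xb]; first exact: meas3_box (fun k => y 0 k - e) (fun k => y 0 k + e).
by apply: Ay => k; rewrite ler_norml; have := xb k; lra.
Qed.

End Volume.

(** * Volume of the hull with a point *)

Lemma strict_ineqs_open (R : realFieldType) (J : finType) (a : J -> 'rV[R]_3) (b : J -> R)
    (y : 'rV[R]_3) : (forall j, dot (a j) y < b j) ->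
  exists2 e, 0 < e & forall x : 'rV[R]_3, (forall k, `|x 0 k - y 0 k| <= e) ->
    forall j, dot (a j) x < b j.
Proof.
move=> ay; have sl j : 0 < b j - dot (a j) y by rewrite subr_gt0.
pose l j := `|a j 0 0| + `|a j 0 1| + `|a j 0 2|.
have [e e0 he] := finite_eps l sl; exists e => // x xy j.
have -> : dot (a j) x = dot (a j) y + (a j 0 0 * (x 0 0 - y 0 0) + a j 0 1 * (x 0 1 - y 0 1)
   + a j 0 2 * (x 0 2 - y 0 2)) by rewrite /dot; ring.
have b1 k : a j 0 k * (x 0 k - y 0 k) <= e * `|a j 0 k|.
  by apply: le_trans (ler_norm _) _; rewrite normrM mulrC ler_wpM2r.
have := he j; have l0 : 0 <= l j by rewrite /l !addr_ge0.
rewrite (ger0_norm l0) /l; have := b1 0; have := b1 1; have := b1 2.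
lra.
Qed.

Section Pyramids.
Context {R : realType} {I : finType}.
Variables (n : I -> 'rV[R]_3) (h : I -> R) (sigma : R).
Hypothesis sigma01 : 0 < sigma <= 1.
Implicit Types (x y : 'rV[R]_3) (i j : I).

(** It is positive when [x] sees the facet [i]. *)
Definition excess i x := dot (n i) x - h i.
Local Notation f := excess.

Definition polytope : set 'rV[R]_3 := [set p | forall i, f i p <= 0].

(** For [s < 1] the condition says that [y = (1 - s) p + s x] with [p] in the
    polytope: [s] is the share of the apex [x] in [y], and it is limited to
    [sigma]. *)
Definition hull x : set 'rV[R]_3 :=
  [set y | exists2 s, 0 <= s <= sigma & forall j, f j y <= s * f j x].

(** The points whose share of the apex is [f i y / f i x], the other share being
    that of a point of the facet [i] on no other facet. This makes the pyramids
    over different facets disjoint. *)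
Definition pyramid i x : set 'rV[R]_3 := [set y | [/\ 0 < f i y, f i y <= sigma * f i x &
  forall j, j != i -> f j y < (f i y / f i x) * f j x]].

Let excess_ratio i j x y : f j y - (f i y / f i x) * f j x =
  dot (n j - (f j x / f i x) *: n i) y - (h j - (f j x / f i x) * h i).
Proof. by rewrite !dotE /(f i y) /(f j y); ring. Qed.

Lemma meas3_pyramid i x : meas3 (pyramid i x).
Proof.
pose F j := if j == i then setT else
  [set y | dot (n j - (f j x / f i x) *: n i) y < h j - (f j x / f i x) * h i].
have mF j : meas3 (F j).
  by rewrite /F; case: eqP => _; [exact: measurableT | exact: meas3_lt].
have := meas3I (meas3I (meas3_gt (n i) (- h i)) (meas3_le (n i) (sigma * f i x + h i)))
  (meas3_forall mF).
congr meas3; apply/seteqP; split=> y /=.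
  case=> -[h1 h2 h3]; split=> //; first by rewrite /excess in h1 h2 *; lra.
  by move=> j ji; have := h3 j; rewrite /F (negPf ji) /= -subr_lt0 -excess_ratio subr_lt0.
case=> h1 h2 h3; split; first by rewrite /excess in h1 h2 *; split; lra.
move=> j; rewrite /F; case: eqP => // /eqP ji /=.
by rewrite -subr_lt0 -excess_ratio subr_lt0 h3.
Qed.

Definition closed_pyramid i x : set 'rV[R]_3 := [set y | [/\ 0 < f i y, f i y <= sigma * f i x &
  forall j, f j y <= (f i y / f i x) * f j x]].

Lemma meas3_closed_pyramid i x : meas3 (closed_pyramid i x).
Proof.
pose F j := [set y | dot (n j - (f j x / f i x) *: n i) y <= h j - (f j x / f i x) * h i].
have mF j : meas3 (F j) by exact: meas3_le.
have := meas3I (meas3I (meas3_gt (n i) (- h i)) (meas3_le (n i) (sigma * f i x + h i)))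
  (meas3_forall mF).
congr meas3; apply/seteqP; split=> y /=.
  case=> -[h1 h2 h3]; split=> [||j]; try by rewrite /excess in h1 h2 *; lra.
  by have := h3 j; rewrite /F /= -subr_le0 -excess_ratio subr_le0.
case=> h1 h2 h3; split; first by rewrite /excess in h1 h2 *; split; lra.
by move=> j; rewrite /F /= -subr_le0 -excess_ratio subr_le0 h3.
Qed.

Lemma meas3_polytope : meas3 polytope.
Proof.
have := meas3_forall (fun i => meas3_le (n i) (h i)); congr meas3.
by apply/seteqP; split=> y /= hy i; have := hy i; rewrite /excess; lra.
Qed.

Let excess_set_coord j k x c : f j (set_coord k x c) = f j (set_coord k x 0) + n j 0 k * c.
Proof. by rewrite /excess dot_set_coord; ring. Qed.

Definition axis_shift k x t := set_coord k x (x 0 k + t).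

Let excess_shift j k x t : f j (axis_shift k x t) = f j x + t * n j 0 k.
Proof.
have {2}-> : x = set_coord k x (x 0 k) by apply/rowP => l; rewrite mxE; case: eqP => [->|].
by rewrite /axis_shift excess_set_coord [in RHS]excess_set_coord; ring.
Qed.

(** Moving the apex along a coordinate axis by [t] moves each point of the pyramid
    along it by [t] times its share of the apex. *)
Let pyramid_shift i k x t : 0 < f i x -> 0 < f i (axis_shift k x t) ->
  vol (pyramid i (axis_shift k x t)) = ((f i (axis_shift k x t) / f i x)%:E * vol (pyramid i x))%E.
Proof.
move=> fx fx'; set x' := axis_shift k x t.
apply: (@vol_affine R k _ (fun y => t * (f i (set_coord k y 0) / f i x))).
- exact: divr_gt0.
- exact: meas3_pyramid.
- exact: meas3_pyramid.
move=> y c; set Y := set_coord k y c; set c' := _ + _; set Y' := set_coord k y c'.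
pose s := f i Y / f i x.
have fx0 : f i x != 0 by rewrite gt_eqF.
have fx0' : f i x' != 0 by rewrite gt_eqF.
have ec : c' = c + t * s.
  rewrite /c' /s /Y [in RHS]excess_set_coord /x' excess_shift; field.
  exact: fx0.
have fY j : f j Y' = f j Y + s * (f j x' - f j x).
  rewrite /Y' /Y excess_set_coord [f j (set_coord k y c)]excess_set_coord ec /x' excess_shift; ring.
have fiY : f i Y = s * f i x by rewrite /s divfK.
have fiY' : f i Y' = s * f i x' by rewrite fY fiY; ring.
rewrite /pyramid /= fiY' fiY !mulfK // !pmulr_lgt0 ?invr_gt0 // !ler_pM2r //.
by split=> -[h1 h2 h3]; split=> // j ji; have := h3 j ji; rewrite fY; lra.
Qed.

(** For an apex that sees the facet [i] this is the area of the facet times a factor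
    that does not depend on [x]. *)
Let density i x := ((f i x)^-1%:E * vol (pyramid i x))%E.

Let density_shift i k x t : 0 < f i x -> 0 < f i (axis_shift k x t) ->
  density i (axis_shift k x t) = density i x.
Proof.
move=> fx fx'; rewrite /density (pyramid_shift fx fx') muleA -EFinM; congr (_%:E * _)%E.
by rewrite mulrA mulVf ?mul1r // gt_eqF.
Qed.

(** The apex first moves away from the facet plane, far enough to see the facet
    throughout, then to its final position in the other two directions, and finally
    back. *)
Let density_path i k0 k1 k2 x y : (forall k : 'I_3, [|| k == k0, k == k1 | k == k2]) ->
  k0 != k1 -> k0 != k2 -> k1 != k2 ->
  n i 0 k0 != 0 -> 0 < f i x -> 0 < f i y -> density i x = density i y.
Proof.
move=> kk k01 k02 k12 nk fx fy.
pose d k := y 0 k - x 0 k.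
pose S := `|d k1 * n i 0 k1| + `|d k2 * n i 0 k2|.
have a1 : - `|d k1 * n i 0 k1| <= d k1 * n i 0 k1 by rewrite lerNl -normrN ler_norm.
have a2 : - `|d k2 * n i 0 k2| <= d k2 * n i 0 k2 by rewrite lerNl -normrN ler_norm.
have b1 : 0 <= `|d k1 * n i 0 k1| by [].
have b2 : 0 <= `|d k2 * n i 0 k2| by [].
pose x1 := axis_shift k0 x (S / n i 0 k0).
pose x2 := axis_shift k1 x1 (d k1).
pose x3 := axis_shift k2 x2 (d k2).
have f1 : f i x1 = f i x + S by rewrite /x1 excess_shift divfK.
have f2 : f i x2 = f i x1 + d k1 * n i 0 k1 by rewrite /x2 excess_shift.
have f3 : f i x3 = f i x2 + d k2 * n i 0 k2 by rewrite /x3 excess_shift.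
have p1 : 0 < f i x1 by rewrite f1 /S; lra.
have p2 : 0 < f i x2 by rewrite f2 f1 /S; lra.
have p3 : 0 < f i x3 by rewrite f3 f2 f1 /S; lra.
have e4 : axis_shift k0 x3 (y 0 k0 - x3 0 k0) = y.
  rewrite /x3 /x2 /x1 /axis_shift; apply/rowP => k; rewrite !mxE !eqxx.
  have := kk k; case: (eqVneq k k0) => [->|_] /=; first by rewrite addrC subrK.
  case: (eqVneq k k1) => [->|_] /=.
    by rewrite (negPf k12) (eq_sym k1) (negPf k01) /d addrC subrK.
  by move=> /eqP->; rewrite !eqxx (eq_sym k2 k1) (negPf k12) (eq_sym k2) (negPf k02) /d addrC subrK.
have p4 : 0 < f i (axis_shift k0 x3 (y 0 k0 - x3 0 k0)) by rewrite e4.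
by rewrite -e4 (density_shift p3 p4) (density_shift p2 p3) (density_shift p1 p2) (density_shift fx p1).
Qed.

Variables (q : I -> 'rV[R]_3) (M : R) (p0 : 'rV[R]_3).
Hypothesis qE : forall i, f i (q i) = 0.
Hypothesis q_lt : forall i j, j != i -> f j (q i) < 0.
Hypothesis bounded : forall p, (forall i, f i p <= 0) -> forall k, `|p 0 k| <= M.
Hypothesis p0P : forall i, f i p0 <= 0.

Let normal_neq0 i x : 0 < f i x -> n i != 0.
Proof.
by apply: contraTneq => n0; have := qE i; rewrite /excess n0 !dot0l => ->; rewrite ltxx.
Qed.

Let density_const i x y : 0 < f i x -> 0 < f i y -> density i x = density i y.
Proof.
move=> fx fy; have [k nk] : exists k, n i 0 k != 0.
  apply/existsP; apply: contraNT (normal_neq0 fx) => /existsPn hn; apply/eqP/row3P; rewrite mxE;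
    by apply/eqP; have := hn 0; have := hn 1; have := hn 2; rewrite !negbK.
elim/ord3_ind: k nk => nk.
- by apply: (@density_path i 0 1 2) => //; exact: ord3_ind.
- by apply: (@density_path i 1 0 2) => //; exact: ord3_ind.
- by apply: (@density_path i 2 0 1) => //; exact: ord3_ind.
Qed.

Let sigma0 : 0 < sigma. Proof. by case/andP: sigma01. Qed.

Let vol_pyramid_gt0 i x : 0 < f i x -> (0 < vol (pyramid i x))%E.
Proof.
move=> fx; pose s := sigma / 2.
have s0 : 0 < s by rewrite divr_gt0.
have s1 : s < 1 by case/andP: sigma01 => _; rewrite /s; lra.
(* an interior point of the pyramid *)
pose y := (1 - s) *: q i + s *: x.
have fy j : f j y = (1 - s) * f j (q i) + s * f j x by rewrite /y /excess !dotE; ring.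
have fiy : f i y = s * f i x by rewrite fy qE mulr0 add0r.
have fx0 : f i x != 0 by rewrite gt_eqF.
pose a (j : I + bool) := match j with
  | inl j => if j == i then 0 else n j - (f j x / f i x) *: n i
  | inr b => if b then n i else - n i end.
pose b (j : I + bool) := match j with
  | inl j => if j == i then 1 else h j - (f j x / f i x) * h i
  | inr b => if b then sigma * f i x + h i else - h i end.
have aby (j : I + bool) : dot (a j) y < b j.
  case: j => [j|[]] /=.
  - case: eqP => [_|/eqP ji]; first by rewrite dot0l.
    rewrite -subr_lt0 -excess_ratio fiy mulfK // fy addrK.
    by rewrite pmulr_rlt0 ?q_lt //; lra.
  - have : 0 < s * f i x by rewrite mulr_gt0.
    by have := fiy; rewrite {1}/excess /s; lra.
  - have : 0 < s * f i x by rewrite mulr_gt0.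
    by have := fiy; rewrite {1}/excess dotNl; lra.
have [e e0 he] := strict_ineqs_open aby.
apply: (vol_cube_gt0 (y := y) e0 (meas3_pyramid i x)) => z /he hz; split.
- by have := hz (inr false); rewrite /= /excess dotNl ltrNl opprK subr_gt0.
- by have := hz (inr true); have : f i z = dot (n i) z - h i by []; rewrite /=; lra.
- by move=> j ji; have := hz (inl j); rewrite /= (negPf ji) -subr_lt0 -excess_ratio subr_lt0.
Qed.

(** Sliding a point of the hull by the share of the apex in it leads back into
    the polytope. *)
Let hull_bounded x y : hull x y -> forall k, `|y 0 k| <= M + `|p0 0 k - x 0 k|.
Proof.
case=> s /andP[s0 s1] fy k.
have /bounded/(_ k) : forall i, f i (y + s *: (p0 - x)) <= 0.
  move=> i; have -> : f i (y + s *: (p0 - x)) = f i y - s * f i x + s * f i p0.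
    by rewrite /excess !dotE; ring.
  by have := fy i; have := mulr_ge0_le0 s0 (p0P i); lra.
rewrite !mxE => h1.
have -> : y 0 k = y 0 k + s * (p0 0 k - x 0 k) - s * (p0 0 k - x 0 k) by rewrite addrK.
apply: le_trans (ler_normB _ _) _; apply: lerD => //.
rewrite normrM (ger0_norm s0) ler_piMl //.
by case/andP: sigma01 => _; exact: le_trans.
Qed.

Let pyramid_hull i x y : pyramid i x y -> hull x y.
Proof.
case=> h1 h2 h3; have fx : 0 < f i x.
  by have := lt_le_trans h1 h2; rewrite pmulr_rgt0.
exists (f i y / f i x).
  by apply/andP; split; [exact: divr_ge0 (ltW h1) (ltW fx) | rewrite ler_pdivrMr].
by move=> j; have [->|ji] := eqVneq j i; [rewrite divfK // gt_eqF | rewrite ltW // h3].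
Qed.

Let meas_bounded_fin A x : meas3 A -> A `<=` hull x -> (vol A < +oo)%E.
Proof.
move=> mA AH; apply: (vol_bounded (M := M + `|p0 0 0 - x 0 0| + `|p0 0 1 - x 0 1| + `|p0 0 2 - x 0 2|)) => //.
move=> y /AH/hull_bounded hy k; apply: le_trans (hy k) _.
have := normr_ge0 (p0 0 0 - x 0 0); have := normr_ge0 (p0 0 1 - x 0 1).
have := normr_ge0 (p0 0 2 - x 0 2).
by elim/ord3_ind: k {hy}; lra.
Qed.

Let polytope_hull x y : polytope y -> hull x y.
Proof. by move=> Py; exists 0; [rewrite lexx ltW | move=> j; rewrite mul0r Py]. Qed.

(** Where the pyramids over [i] and [j] touch. *)
Let wall i j x := [set y | f j y = (f i y / f i x) * f j x].

Let wallE i j x : wall i j x = [set y | dot (n j - (f j x / f i x) *: n i) y =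
  h j - (f j x / f i x) * h i].
Proof.
apply/seteqP; split=> y /= e; have := excess_ratio i j x y; rewrite e subrr.
  by move/esym/eqP; rewrite subr_eq0 => /eqP.
by move/eqP; rewrite subr_eq0 => /eqP.
Qed.

Let meas3_wall i j x : meas3 (wall i j x).
Proof. by rewrite wallE; exact: meas3_plane. Qed.

(** The equation of the wall is not trivial, since [q i] does not satisfy it. *)
Let vol_wall i j x : 0 < f i x -> j != i -> vol (wall i j x) = 0%E.
Proof.
move=> fx ji; rewrite wallE.
have [n0|/vol_plane-> //] := eqVneq (n j - (f j x / f i x) *: n i) 0.
rewrite (_ : mkset _ = set0) ?vol0 //; apply/seteqP; split=> // y /=.
rewrite n0 dot0l => h0.
have := excess_ratio i j x (q i); rewrite n0 dot0l -h0 qE mul0r mul0r !subr0 => fq.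
by have := q_lt ji; rewrite fq ltxx.
Qed.

Let visible_pyramid x i := if 0 < f i x then pyramid i x else set0.
Let visible_wall x (ij : I * I) := if (0 < f ij.1 x) && (ij.2 != ij.1) then wall ij.1 ij.2 x else set0.

Let cells x := polytope `|` [set y | exists2 i, i \in enum I & visible_pyramid x i y].
Let walls x := [set y | exists2 ij, ij \in enum {: I * I} & visible_wall x ij y].

Let cells_hull x : cells x `<=` hull x.
Proof.
move=> y [/polytope_hull//|[i _]]; rewrite /visible_pyramid; case: ifP => // _; exact: pyramid_hull.
Qed.

(** A point of the hull outside the polytope lies in the pyramid over the
    visible facet [i] for which [f i y / f i x] is largest: this ratio is the share
    of the apex in it. *)
Let hull_closed_pyramid x y : hull x y -> polytope y \/ exists i, 0 < f i x /\ closed_pyramid i x y.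
Proof.
case=> s /andP[s0 s1] fy.
have [/forallP Py|/forallPn[i0]] := boolP [forall i, f i y <= 0]; first by left.
rewrite -ltNge => fi0; right.
have vis i : 0 < f i y -> 0 < f i x.
  move=> fiy; have : 0 < s * f i x by exact: lt_le_trans (fy i).
  by rewrite lt_neqAle eq_sym mulf_eq0 negb_or => /andP[/andP[sn fn] sf];
    rewrite lt_neqAle eq_sym fn -(pmulr_rge0 _ (_ : 0 < s)) // lt_neqAle eq_sym sn.
pose i := [arg max_(i > i0 | 0 < f i y) (f i y / f i x)]%O.
have [fiy imax] : 0 < f i y /\ forall j, 0 < f j y -> f j y / f j x <= f i y / f i x.
  by rewrite /i; case: arg_maxP.
have fix0 := vis i fiy; exists i; split=> //; set r := f i y / f i x in imax.
have r0 : 0 < r by rewrite divr_gt0.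
have rs : r <= s by rewrite ler_pdivrMr.
split=> // [|j]; first by rewrite -ler_pdivrMr // (le_trans rs).
have [fjy|fjy] := ltrP 0 (f j y); first by rewrite -ler_pdivrMr ?imax // vis.
have [fjx|fjx] := ltrP 0 (f j x).
  by apply: le_trans fjy _; rewrite mulr_ge0 // ltW.
by apply: le_trans (fy j) _; rewrite ler_wnM2r.
Qed.

Let closed_pyramid_hull i x y : 0 < f i x -> closed_pyramid i x y -> hull x y.
Proof.
move=> fx [h1 h2 h3]; exists (f i y / f i x) => //.
by apply/andP; split; [exact: divr_ge0 (ltW h1) (ltW fx) | rewrite ler_pdivrMr].
Qed.

Lemma meas3_hull x : meas3 (hull x).
Proof.
pose F i := if 0 < f i x then closed_pyramid i x else set0.
have mF i : meas3 (F i) by rewrite /F; case: ifP => _; [exact: meas3_closed_pyramid | exact: meas3_0].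
have := meas3U meas3_polytope (meas3_exists mF); congr meas3.
apply/seteqP; split=> y.
  by case=> [/polytope_hull//|[i]]; rewrite /F; case: ifP => // fx; exact: closed_pyramid_hull.
case/hull_closed_pyramid=> [Py|[i [fx cy]]]; [by left | right].
by exists i; rewrite /F fx.
Qed.

Let hull_cells_walls x : hull x `<=` cells x `|` walls x.
Proof.
move=> y /hull_closed_pyramid[Py|[i [fx [h1 h2 h3]]]]; first by left; left.
have [/forallP ne|/forallPn[j]] :=
    boolP [forall j, (j != i) ==> (f j y != f i y / f i x * f j x)].
  left; right; exists i; rewrite ?mem_enum // /visible_pyramid fx; split=> // j ji.
  by rewrite lt_neqAle h3 andbT; have := ne j; rewrite ji.
rewrite negb_imply negbK => /andP[ji /eqP e]; right.
by exists (i, j); rewrite ?mem_enum // /visible_wall /= fx ji.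
Qed.

Let weight i := fine (density i (q i + n i)).

Let excess_apex i x : 0 < f i x -> 0 < f i (q i + n i).
Proof.
move=> fx; have -> : f i (q i + n i) = f i (q i) + dot (n i) (n i) by rewrite /excess dotDr; ring.
by rewrite qE add0r dotvv_gt0 // (normal_neq0 fx).
Qed.

Let vol_pyramid i x : 0 < f i x -> vol (pyramid i x) = (weight i * f i x)%:E /\ 0 < weight i.
Proof.
move=> fx; have fa := excess_apex fx.
have fin : vol (pyramid i x) \is a fin_num.
  by rewrite ge0_fin_numE ?vol_ge0 //; apply: (meas_bounded_fin (meas3_pyramid i x)) => y; exact: pyramid_hull.
have v0 : 0 < fine (vol (pyramid i x)) by rewrite fine_gt0 // vol_pyramid_gt0 //= -ge0_fin_numE ?vol_ge0.
have -> : weight i = (f i x)^-1 * fine (vol (pyramid i x)).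
  by rewrite /weight (density_const fa fx) /density -(fineK fin) -EFinM.
by rewrite mulrAC mulVf ?gt_eqF // mul1r fineK // mulr_gt0 ?invr_gt0.
Qed.

Let meas3_visible_pyramid x i : meas3 (visible_pyramid x i).
Proof. by rewrite /visible_pyramid; case: ifP => _; [exact: meas3_pyramid | exact: meas3_0]. Qed.

Let meas3_cells x : meas3 (cells x).
Proof.
by apply: meas3U; [exact: meas3_polytope | apply: meas3_seq => i; exact: meas3_visible_pyramid].
Qed.

Let meas3_visible_wall x ij : meas3 (visible_wall x ij).
Proof. by rewrite /visible_wall; case: ifP => _; [exact: meas3_wall | exact: meas3_0]. Qed.

Let vol_hull_cells x : vol (hull x) = vol (cells x).
Proof.
apply: le_anti; apply/andP; split; last first.
  by apply: le_vol; [exact: meas3_cells | exact: meas3_hull | exact: cells_hull].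
have mt : meas3 (walls x) by apply: meas3_seq => ij; exact: meas3_visible_wall.
have t0 : vol (walls x) = 0%E.
  apply: vol_null_union => ij; first exact: meas3_visible_wall.
  by rewrite /visible_wall; case: ifP => [/andP[fx ji]|_]; [exact: vol_wall | exact: vol0].
rewrite -(volU0 (meas3_cells x) mt t0); apply: le_vol; [exact: meas3_hull | | exact: hull_cells_walls].
by apply: meas3U.
Qed.

Let vol_cells x : vol (cells x) = (vol polytope + \sum_i vol (visible_pyramid x i))%E.
Proof.
rewrite /cells vol_disjoint_union ?enum_uniq //.
- by rewrite big_enum.
- exact: meas3_polytope.
- move=> i; apply/seteqP; split=> // y [/= Py]; rewrite /visible_pyramid; case: ifP => // _ [fy _ _].
  by have := Py i; rewrite leNgt fy.
- move=> i j ij; apply/seteqP; split=> // y [/=].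
  rewrite /visible_pyramid; case: ifP => // fi [yi _ hi]; case: ifP => // fj [yj _ hj].
  have := hi j; rewrite eq_sym => /(_ ij); rewrite -ltr_pdivrMr // => h1.
  have := hj i ij; rewrite -ltr_pdivrMr // => h2.
  by have := lt_trans h1 h2; rewrite ltxx.
Qed.

(** Up to the walls the hull is the disjoint union of the polytope and of the
    pyramids over the facets that [x] sees. *)
Theorem vol3_hull : exists2 k : I -> R, (forall i, 0 < k i) &
  forall x, vol3 (hull x) = vol3 polytope + \sum_i k i * Num.max 0 (dot (n i) x - h i).
Proof.
(* if [n i = 0], no point sees the facet [i], and any positive weight will do *)
exists (fun i => if 0 < f i (q i + n i) then weight i else 1) => [i|x].
  by case: ifP => // fa; case: (vol_pyramid fa).
rewrite !vol3E vol_hull_cells vol_cells.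
have finP : vol polytope \is a fin_num.
  by rewrite ge0_fin_numE ?vol_ge0 //; apply: (meas_bounded_fin (x := 0) meas3_polytope) => y; exact: polytope_hull.
have -> : (\sum_i vol (visible_pyramid x i) = (\sum_i (if 0 < f i (q i + n i) then weight i else 1) *
    Num.max 0 (dot (n i) x - h i))%:E)%E.
  rewrite -sumEFin; apply: eq_bigr => i _; rewrite /visible_pyramid -/(f i x).
  case: (ltrP 0 (f i x)) => fx; last by rewrite mulr0 vol0.
  by rewrite (vol_pyramid fx).1 (excess_apex fx).
by rewrite -(fineK finP) -EFinD.
Qed.

End Pyramids.

(** * Convex hulls of finite sets *)

Section ConvexHull.
Context {R : realType}.
Implicit Types (A B : set 'rV[R]_3) (x y z : 'rV[R]_3).

Definition convex_comb_closed A := forall (t : R) x y, 0 <= t <= 1 -> A x -> A y ->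
  A ((1 - t) *: x + t *: y).

Lemma convex_setP A : convex_set A <-> convex_comb_closed A.
Proof.
split=> cA.
  move=> t x y /andP[t0 t1] Ax Ay.
  have := cA y x (Itv01 t0 t1); rewrite !inE => /(_ Ay Ax).
  by rewrite addrC.
move=> x y l; rewrite !inE => Ax Ay.
have -> : convex.conv l x y = (1 - l%:num) *: y + l%:num *: x :> 'rV[R]_3 by rewrite addrC.
by apply: cA => //; apply/andP; split.
Qed.

Lemma convex_hull_convex A : convex_comb_closed (convex_hull A).
Proof.
move=> t x y t01 hx hy B BA; case: (BA) => /convex_setP cB _.
by apply: cB => //; [exact: hx | exact: hy].
Qed.

Lemma sub_convex_hull A : A `<=` convex_hull A.
Proof. exact: sub_gen_smallest. Qed.

Lemma convex_hull_sub A B : convex_comb_closed B -> A `<=` B -> convex_hull A `<=` B.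
Proof. by move=> cB; apply: smallest_sub; exact/convex_setP. Qed.

Lemma convex_le (n : 'rV[R]_3) (b : R) : convex_comb_closed [set x | dot n x <= b].
Proof.
move=> t x y /andP[t0 t1] /= hx hy; rewrite !dotE.
have : (1 - t) * dot n x <= (1 - t) * b by rewrite ler_wpM2l // subr_ge0.
have : t * dot n y <= t * b by rewrite ler_wpM2l.
lra.
Qed.

Lemma convex_hull_le (n : 'rV[R]_3) (b : R) A : (forall x, A x -> dot n x <= b) ->
  forall x, convex_hull A x -> dot n x <= b.
Proof. by move=> h; apply: convex_hull_sub; first exact: convex_le. Qed.

Definition seg_point (a : 'rV[R]_3) (tp : R * 'rV[R]_3) := (1 - tp.1) *: tp.2 + tp.1 *: a.

(** The segments from [a] to the hull of the other points; [a] is listed apart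
    because there may be no other points. *)
Lemma convex_hull_cons a (s : seq 'rV[R]_3) : convex_hull [set` a :: s] =
  [set a] `|` seg_point a @` (`[0, 1] `*` convex_hull [set` s]).
Proof.
apply/seteqP; split.
  apply: convex_hull_sub; last first.
    move=> x /=; rewrite inE => /orP[/eqP->|xs]; first by left.
    right; exists (0, x); last by rewrite /seg_point /= subr0 scale1r scale0r addr0.
    by split=> /=; [rewrite in_itv /= lexx ler01 | exact: sub_convex_hull].
  have mix t u p : 0 <= t <= 1 -> 0 <= u <= 1 -> convex_hull [set` s] p ->
      (1 - t) *: a + t *: seg_point a (u, p) = seg_point a (1 - t * (1 - u), p).
    by move=> _ _ _; rewrite /seg_point; apply: row3P; rewrite !mxE /=; ring.
  have in01 (t u : R) : 0 <= t <= 1 -> 0 <= u <= 1 -> 0 <= 1 - t * (1 - u) <= 1.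
    move=> /andP[t0 t1] /andP[u0 u1].
    have a0 : 0 <= t * (1 - u) by rewrite mulr_ge0 // subr_ge0.
    have a1 : t * (1 - u) <= 1 by rewrite mulr_ile1 // ?subr_ge0 // lerBlDr lerDl.
    by apply/andP; split; lra.
  have flip (t : R) : 0 <= t <= 1 -> 0 <= 1 - t <= 1 by move=> /andP[? ?]; apply/andP; split; lra.
  move=> t x y t01 [->|[[u p] [/= + Hp] <-]] [->|[[v r] [/= + Hr] <-]].
  - by left; rewrite -scalerDl subrK scale1r.
  - rewrite in_itv /= => v01; right; exists (1 - t * (1 - v), r); last by rewrite mix.
    by split=> //=; rewrite in_itv /= in01.
  - rewrite in_itv /= => u01; right; exists (1 - (1 - t) * (1 - u), p).
      by split=> //=; rewrite in_itv /= in01 // flip.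
    by rewrite -mix ?flip // subKr addrC.
  - rewrite !in_itv /= => u01 v01; right.
    (* [S], [w] and [w'] are the shares of [a], [p] and [r] in the combination *)
    pose S := (1 - t) * u + t * v; pose w := (1 - t) * (1 - u); pose w' := t * (1 - v).
    have w0 : 0 <= w by case/andP: t01 u01 => [? ?] /andP[? ?]; rewrite mulr_ge0 ?subr_ge0.
    have w'0 : 0 <= w' by case/andP: t01 v01 => [? ?] /andP[? ?]; rewrite mulr_ge0 ?subr_ge0.
    have SE : 1 - S = w + w' by rewrite /S /w /w'; ring.
    have S0 : 0 <= S by case/andP: t01 u01 v01 => [? ?] /andP[? ?] /andP[? ?];
      rewrite addr_ge0 // mulr_ge0 ?subr_ge0.
    have [S1|S1] := eqVneq (w + w') 0.
      have w00 : w = 0 by lra.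
      have w'00 : w' = 0 by lra.
      exists (1, p); first by split=> //=; rewrite in_itv /= ler01 lexx.
      have -> : (1 - t) *: seg_point a (u, p) + t *: seg_point a (v, r) =
        w *: p + w' *: r + (1 - (w + w')) *: a.
        by rewrite /seg_point /w /w'; apply: row3P; rewrite !mxE /=; ring.
      by rewrite w00 w'00 /seg_point /= subrr !scale0r !addr0 subr0.
    have W0 : 0 < w + w' by rewrite lt_neqAle eq_sym S1 addr_ge0.
    exists (S, (1 - w' / (w + w')) *: p + (w' / (w + w')) *: r).
      split=> /=; first by rewrite in_itv /= S0 /=; lra.
      apply: convex_hull_convex => //.
      by rewrite divr_ge0 ?(ltW W0) //= ler_pdivrMr // mul1r lerDr.
    rewrite /seg_point /= SE scalerDr !scalerA mulrBr mulr1 (mulrC (w + w')) divfK // addrK.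
    by rewrite /S /w /w'; apply: row3P; rewrite !mxE /=; ring.
move=> x [->|[[t p] [/= + Hp] <-]].
  by apply: sub_convex_hull; rewrite /= inE eqxx.
rewrite in_itv /= => t01; apply: convex_hull_convex => //.
  apply: convex_hull_sub Hp; first exact: convex_hull_convex.
  by move=> y ys; apply: sub_convex_hull; rewrite /= inE ys orbT.
by apply: sub_convex_hull; rewrite /= inE eqxx.
Qed.

Lemma seg_point_continuous a : continuous (seg_point a).
Proof.
move=> tp; apply: cvgD.
  apply: cvgZ; last exact: cvg_snd.
  by apply: cvgB; [exact: cvg_cst | exact: cvg_fst].
by apply: cvgZ; [exact: cvg_fst | exact: cvg_cst].
Qed.

Lemma convex_hull_nil : convex_hull [set` [::] : seq 'rV[R]_3] = set0.
Proof. by apply/seteqP; split=> //; apply: convex_hull_sub. Qed.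

Lemma convex_hull_compact (s : seq 'rV[R]_3) : compact (convex_hull [set` s]).
Proof.
elim: s => [|a s IH]; first by rewrite convex_hull_nil; exact: compact0.
rewrite convex_hull_cons; apply: compactU; first exact: compact_set1.
apply: continuous_compact; last by apply: compact_setX => //; exact: segment_compact.
by apply: continuous_subspaceT; exact: seg_point_continuous.
Qed.

Lemma sqdist_continuous x : continuous (fun y : 'rV[R]_3 => dot (x - y) (x - y)).
Proof.
move=> y; rewrite /dot.
have c k : (fun z : 'rV[R]_3 => (x - z) 0 k) @ y --> (x - y) 0 k.
  have -> : (fun z : 'rV[R]_3 => (x - z) 0 k) = (fun z => x 0 k - z 0 k).
    by apply/funext => z; rewrite !mxE.
  rewrite !mxE; apply: (@cvgB _ _ _ (nbhs y) _ (cst (x 0 k)) (fun z : 'rV[R]_3 => z 0 k)).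
    exact: cvg_cst.
  exact: coord_continuous.
exact: (cvgD (cvgD (cvgM (c 0) (c 0)) (cvgM (c 1) (c 1))) (cvgM (c 2) (c 2))).
Qed.

(** The direction from the nearest point of [A] to [x] separates. *)
Lemma separation A p0 x : A p0 -> compact A -> convex_comb_closed A -> ~ A x ->
  exists n, forall y, A y -> dot n y < dot n x.
Proof.
move=> A0 cA convA Ax.
have [p pA pmin] := compact_EVT_min (ex_intro _ p0 A0) cA
  (continuous_subspaceT (@sqdist_continuous x)).
move: pA; rewrite inE => Ap; exists (x - p) => y Ay.
have xp : x - p != 0 by rewrite subr_eq0; apply/eqP => xp; apply: Ax; rewrite xp.
have obt : dot (x - p) (y - p) <= 0.
  rewrite leNgt; apply/negP => gt.
  pose a := dot (x - p) (y - p); pose b := dot (y - p) (y - p).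
  have b0 : 0 <= b by exact: dotvv_ge0.
  (* a step towards [y] short enough to come nearer to [x] *)
  pose t := a / (a + b).
  have ab : 0 < a + b by rewrite /a; lra.
  have t0 : 0 < t by rewrite divr_gt0.
  have t1 : t <= 1 by rewrite ler_pdivrMr // mul1r; lra.
  have /pmin : (1 - t) *: p + t *: y \in A by rewrite inE; apply: convA => //; rewrite ltW.
  have -> : dot (x - ((1 - t) *: p + t *: y)) (x - ((1 - t) *: p + t *: y)) =
      dot (x - p) (x - p) - t * (a + (a - t * b)).
    by rewrite /a /b /dot !mxE; ring.
  have tE : t * (a + b) = a by rewrite divfK // gt_eqF.
  have a0 : 0 < a by [].
  have tb : t * b < a.
    have := mulr_gt0 t0 a0; have : t * a + t * b = a by rewrite -mulrDr.
    by move: (t * a) (t * b) => ? ?; clearbody a; lra.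
  have : 0 < t * (a + (a - t * b)) by rewrite mulr_gt0 // addr_gt0 // subr_gt0.
  by move: (t * _) => c; lra.
have := dotvv_gt0 xp; move: obt; rewrite !dotE; lra.
Qed.

End ConvexHull.

(** * Facets of a polytope *)

Lemma interior_cube (R : realType) (A : set 'rV[R]_3) p : interior A p ->
  exists2 e, 0 < e & forall x : 'rV[R]_3, (forall k, `|x 0 k - p 0 k| < e) -> A x.
Proof.
move=> /nbhs_ballP[e /= e0 pA]; exists e => // x xp; apply: pA; split=> // i k.
by rewrite /ball /= ord1 distrC.
Qed.

Section Facets.
Context {R : realType}.
Variable ws : seq 'rV[R]_3.
Implicit Types n d z v : 'rV[R]_3.
(** The origin is interior to the convex hull of [ws]. *)
Hypothesis spanning : forall d, d != 0 -> exists2 v, v \in ws & 0 < dot d v.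

Definition polar n := forall v, v \in ws -> dot n v <= 1.

(** The functional [n] is moved along [d] or [- d], whichever does not decrease its
    value at [z], until it reaches 1 at some new point. *)
Lemma push_to_tight n d z : polar n -> 1 < dot n z -> d != 0 ->
  exists t v, [/\ v \in ws, dot d v != 0, polar (n + t *: d), 1 < dot (n + t *: d) z &
    dot (n + t *: d) v = 1].
Proof.
have half c : polar n -> 1 < dot n z -> c != 0 -> 0 <= dot c z ->
    exists t v, [/\ v \in ws, dot c v != 0, polar (n + t *: c), 1 < dot (n + t *: c) z &
      dot (n + t *: c) v = 1].
  move=> Dn nz c0 cz; have [v0 v0s cv0] := spanning c0.
  have i0 : (index v0 ws < size ws)%N by rewrite index_mem.
  pose w (i : 'I_(size ws)) := ws`_i.
  have wP i : w i \in ws by rewrite mem_nth.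
  have sl i : 0 <= 1 - dot n (w i) by rewrite subr_ge0 Dn.
  have cw : 0 < dot c (w (Ordinal i0)) by rewrite /w /= nth_index.
  have [t [j [t0 cj tj tle]]] := first_exit (d := fun i => dot c (w i)) sl cw.
  exists t, (w j); split; rewrite ?wP ?gt_eqF //.
  - move=> v vs; have iv : (index v ws < size ws)%N by rewrite index_mem.
    by have := tle (Ordinal iv); rewrite /w /= nth_index // !dotE; lra.
  - by rewrite !dotE; have := mulr_ge0 t0 cz; lra.
  - by rewrite !dotE; lra.
move=> Dn nz d0; have [dz|dz] := lerP 0 (dot d z); first exact: half.
have [||t [v [vs dv Dt zt tv]]] := half (- d) Dn nz.
- by rewrite oppr_eq0.
- by rewrite dotNl; lra.
exists (- t), v; rewrite scaleNr -scalerN; split=> //.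
by move: dv; rewrite dotNl oppr_eq0.
Qed.

Definition facet_normal n := polar n /\ exists u v w,
  [/\ u \in ws, v \in ws & w \in ws] /\
  [/\ triple u v w != 0, dot n u = 1, dot n v = 1 & dot n w = 1].

(** Each of three moves, along directions that annihilate the points at which the
    functional already equals 1, adds an independent point to them. *)
Lemma facet_normal_beyond n z : polar n -> 1 < dot n z ->
  exists2 n', facet_normal n' & 1 < dot n' z.
Proof.
move=> Dn nz.
have e0 : row3 1 0 0 != 0 :> 'rV[R]_3.
  by apply/eqP => /(congr1 (fun x : 'rV_3 => x 0 0)); rewrite row3E mxE; lra.
have [t1 [v1 [v1s _ D1 z1 tv1]]] := push_to_tight Dn nz e0; set n1 := _ + _ in D1 z1 tv1.
have v10 : v1 != 0 by apply/eqP => v10; move: tv1; rewrite v10 dot0r; lra.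
have [d d0 dv1] := ex_orth v1.
have [t2 [v2 [v2s dv2 D2 z2 tv2]]] := push_to_tight D1 z1 d0; set n2 := _ + _ in D2 z2 tv2.
have tv12 : dot n2 v1 = 1 by rewrite /n2 dotDl dotZl tv1 (dotC d) dv1 mulr0 addr0.
have c0 : cross v1 v2 != 0.
  apply: contra dv2 => /eqP/(cross_eq0 v10)[a ->].
  by rewrite dotZr (dotC d) dv1 mulr0.
have [t3 [v3 [v3s dv3 D3 z3 tv3]]] := push_to_tight D2 z2 c0; set n3 := _ + _ in D3 z3 tv3.
exists n3 => //; split=> //; exists v3, v1, v2; split=> //; split=> //.
- by rewrite /triple dotC.
- by rewrite /n3 dotDl dotZl tv12 dotC dot_cross_l mulr0 addr0.
- by rewrite /n3 dotDl dotZl tv2 dotC dot_cross_r mulr0 addr0.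
Qed.

Definition facet_normals : seq 'rV[R]_3 :=
  undup [seq n <- [seq (triple a.1 a.2.1 a.2.2)^-1 *: cramer a.1 a.2.1 a.2.2 1 1 1 |
    a <- [seq (u, vw) | u <- ws, vw <- [seq (v, w) | v <- ws, w <- ws]]] | `[< facet_normal n >]].

Lemma mem_facet_normals n : n \in facet_normals <-> facet_normal n.
Proof.
rewrite mem_undup mem_filter; split=> [/andP[/asboolP]//|nn].
apply/andP; split; first exact/asboolP.
case: nn => _ [u [v [w [[us vs wsw] [t0 nu nv nw]]]]].
apply/mapP; exists (u, (v, w)).
  by apply/allpairsPdep; exists u, (v, w); split=> //; apply/allpairsPdep; exists v, w.
have := cramerE u v w n; rewrite (dotC u) (dotC v) (dotC w) nu nv nw => <- /=.
by rewrite scalerA mulVf // scale1r.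
Qed.

End Facets.

(** A point outside [P] is separated from it by a functional of the polar, and by
    [facet_normal_beyond] also by a facet normal. A facet normal equals 1 at three
    independent points, and at their barycenter all others are less than 1. *)
Theorem polytope_facets (R : realType) (P : set 'rV[R]_3) p0 :
  convex_polytope P -> interior P p0 ->
  exists N (n : 'I_N -> 'rV[R]_3) (h : 'I_N -> R) (q : 'I_N -> 'rV[R]_3) (M : R),
  [/\ P = [set x | forall i, dot (n i) x <= h i],
      forall i, dot (n i) (q i) = h i,
      forall i j, j != i -> dot (n j) (q i) < h j,
      forall p, (forall i, dot (n i) p <= h i) -> forall k, `|p 0 k| <= M &
      forall i, dot (n i) p0 < h i].
Proof.
case=> V /finite_seqP[s ->] PE; have convP : convex_comb_closed P.
  by rewrite PE; exact: convex_hull_convex.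
have compP : compact P by rewrite PE; exact: convex_hull_compact.
have sP v : v \in s -> P v by rewrite PE => vs; exact: sub_convex_hull.
move=> intP; have [e e0 cube] := interior_cube intP.
have Pp0 : P p0 by apply: cube => k; rewrite subrr normr0.
have P_le n b : (forall v, v \in s -> dot n v <= b) -> forall x, P x -> dot n x <= b.
  by move=> h x; rewrite PE; exact: convex_hull_le.
pose ws := [seq v - p0 | v <- s].
have span d : d != 0 -> exists2 v, v \in ws & 0 < dot d v.
  move=> d0; apply: contrapT => no.
  have le v : v \in s -> dot d v <= dot d p0.
    move=> vs; rewrite leNgt; apply/negP => lt; apply: no.
    by exists (v - p0); [exact: map_f | rewrite !dotE subr_gt0].
  pose c := `|d 0 0| + `|d 0 1| + `|d 0 2| + 1.
  have c0 : 0 < c by rewrite ltr_wpDl // !addr_ge0.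
  have /(P_le _ _ le) : P (p0 + (e / c) *: d).
    apply: cube => k; rewrite !mxE addrAC subrr add0r normrM gtr0_norm ?divr_gt0 //.
    rewrite mulrAC ltr_pdivrMr // ltr_pM2l //.
    have := normr_ge0 (d 0 0); have := normr_ge0 (d 0 1); have := normr_ge0 (d 0 2).
    by rewrite /c; elim/ord3_ind: k; lra.
  rewrite !dotE; have : 0 < e / c * dot d d by rewrite mulr_gt0 ?dotvv_gt0 // divr_gt0.
  by lra.
pose L := facet_normals ws; pose N := size L.
pose n (i : 'I_N) := L`_i; pose h i := 1 + dot (n i) p0.
have nP i : facet_normal ws (n i) by apply/mem_facet_normals; exact: mem_nth.
have fE i x : dot (n i) x - h i = dot (n i) (x - p0) - 1 by rewrite /h !dotE; ring.
have P_n i x : P x -> dot (n i) x <= h i.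
  apply: P_le => v vs; rewrite -subr_le0 fE subr_le0.
  by apply: (nP i).1; exact: map_f.
have n_P x : (forall i, dot (n i) x <= h i) -> P x.
  move=> hx; apply: contrapT => Px.
  have [m mlt] := separation Pp0 compP convP Px.
  have m0 : m != 0 by apply/eqP => m0; have := mlt _ Pp0; rewrite m0 !dot0l ltxx.
  have [v0 v0s mv0] := span m m0.
  have i0 : (index v0 ws < size ws)%N by rewrite index_mem.
  pose w (i : 'I_(size ws)) := ws`_i.
  pose i := [arg max_(i > Ordinal i0) dot m (w i)]%O.
  have imax j : dot m (w j) <= dot m (w i) by rewrite /i; case: arg_maxP => // l _; apply.
  have a0 : 0 < dot m (w i).
    by apply: lt_le_trans (imax (Ordinal i0)); rewrite /w /= nth_index.
  have lt : dot m (w i) < dot m (x - p0).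
    have /mapP[v vs ->] : w i \in ws by exact: mem_nth.
    by rewrite !dotE ltrD2r; apply: mlt; exact: sP.
  have [| |m' /mem_facet_normals m'L] := @facet_normal_beyond R ws span
      ((dot m (w i))^-1 *: m) (x - p0).
  - move=> v vs; rewrite dotZl mulrC ler_pdivrMr // mul1r.
    have iv : (index v ws < size ws)%N by rewrite index_mem.
    by have := imax (Ordinal iv); rewrite /w /= nth_index.
  - by rewrite dotZl mulrC ltr_pdivlMr // mul1r.
  have im : (index m' L < N)%N by rewrite index_mem.
  have := hx (Ordinal im); rewrite -subr_le0 fE /n /= nth_index //; lra.
have /choice[q hq] : forall i, exists q, dot (n i) q = h i /\
    forall j, j != i -> dot (n j) q < h j.
  move=> i; have [_ [u [v [w [[us vs wsw] [t0 nu nv nw]]]]]] := nP i.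
  exists (p0 + 3^-1 *: (u + v + w)).
  have E j : dot (n j) (p0 + 3^-1 *: (u + v + w)) - h j =
      3^-1 * (dot (n j) u + dot (n j) v + dot (n j) w - 3).
    by rewrite fE !dotE; field.
  split; first by apply/eqP; rewrite -subr_eq0 E nu nv nw; apply/eqP; field.
  move=> j ji; rewrite -subr_lt0 E pmulr_rlt0 // subr_lt0.
  have [Dj _] := nP j; have hu := Dj _ us; have hv := Dj _ vs; have hw := Dj _ wsw.
  rewrite lt_neqAle; apply/andP; split; last lra.
  apply/eqP => sum3; move: ji; apply/negP; rewrite negbK.
  have : n j - n i = 0.
    apply: (triple_orth t0); rewrite dotC !dotE ?nu ?nv ?nw.
    - suff : dot (n j) u = 1 by lra. by lra.
    - suff : dot (n j) v = 1 by lra. by lra.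
    - suff : dot (n j) w = 1 by lra. by lra.
  move/eqP; rewrite subr_eq0 => /eqP e1; apply/eqP/val_inj/eqP.
  by rewrite -(nth_uniq 0 (ltn_ord j) (ltn_ord i) (undup_uniq _)); apply/eqP.
pose M := \sum_(v <- s) (`|v 0 0| + `|v 0 1| + `|v 0 2|).
exists N, n, h, q, M; split.
- by apply/seteqP; split=> x; [move=> Px i; exact: P_n | exact: n_P].
- by move=> i; case: (hq i).
- by move=> i; case: (hq i).
- move=> p /n_P; rewrite PE => Pp k.
  have box : convex_comb_closed [set x : 'rV[R]_3 | `|x 0 k| <= M].
    move=> t x y /andP[t0 t1] /= hx hy; rewrite !mxE; apply: le_trans (ler_normD _ _) _.
    rewrite !normrM (ger0_norm t0) ger0_norm ?subr_ge0 //.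
    have : (1 - t) * `|x 0 k| <= (1 - t) * M by rewrite ler_wpM2l // subr_ge0.
    have : t * `|y 0 k| <= t * M by rewrite ler_wpM2l.
    lra.
  apply: (convex_hull_sub box) Pp => v vs /=; rewrite /M (big_rem v) //=.
  have : 0 <= \sum_(y <- rem v s) (`|y 0 0| + `|y 0 1| + `|y 0 2|).
    by apply: sumr_ge0 => y _; rewrite !addr_ge0.
  have := normr_ge0 (v 0 0); have := normr_ge0 (v 0 1); have := normr_ge0 (v 0 2).
  by elim/ord3_ind: k {box}; lra.
- by move=> i; rewrite -subr_lt0 fE subrr dot0r sub0r oppr_lt0 ltr01.
Qed.

(** * Volume functions with homothetic level sets *)

Section VolumeLevelSets.
Context {R : realType} {I : finType}.
Variables (n : I -> 'rV[R]_3) (h : I -> R) (q : I -> 'rV[R]_3) (M : R) (p0 : 'rV[R]_3).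
Hypothesis qE : forall i, dot (n i) (q i) = h i.
Hypothesis q_lt : forall i j, j != i -> dot (n j) (q i) < h j.
Hypothesis bounded : forall p, (forall i, dot (n i) p <= h i) -> forall k, `|p 0 k| <= M.
Hypothesis p0P : forall i, dot (n i) p0 < h i.
Let P : set 'rV[R]_3 := [set x | forall i, dot (n i) x <= h i].

Let polytopeE : polytope n h = P.
Proof. by apply/seteqP; split=> x /= Px i; have := Px i; rewrite /excess subr_le0. Qed.

(** A point [(1 - s) p + s x] with [s <= sigma] is on the segment from [p] to
    [lambda p + sigma x]. *)
Lemma convex_hull_homothet lambda sigma x : 0 <= lambda -> 0 < sigma -> lambda + sigma = 1 ->
  convex_hull (P `|` translate (scale lambda P) (sigma *: x)) = hull n h sigma x.
Proof.
move=> l0 s0 ls; apply/seteqP; split.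
  apply: convex_hull_sub.
    move=> t y z /andP[t0 t1] [a /andP[a0 a1] ya] [b /andP[b0 b1] zb].
    have t1' : 0 <= 1 - t by rewrite subr_ge0.
    exists ((1 - t) * a + t * b).
      rewrite addr_ge0 ?mulr_ge0 //=.
      have : (1 - t) * a <= (1 - t) * sigma by rewrite ler_wpM2l.
      have : t * b <= t * sigma by rewrite ler_wpM2l.
      lra.
    move=> j; have := ler_wpM2l t1' (ya j); have := ler_wpM2l t0 (zb j).
    by rewrite /excess !dotE; lra.
  move=> y [Py|[_ [p Pp <-] <-]].
    exists 0; first by rewrite lexx ltW.
    by move=> j; rewrite mul0r /excess subr_le0; exact: Py.
  exists sigma; first by rewrite lexx ltW.
  move=> j; have := ler_wpM2l l0 (Pp j); rewrite /excess !dotE.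
  have : lambda * h j + sigma * h j = h j by rewrite -mulrDl ls mul1r.
  lra.
move=> y [s /andP[sge sle] fy].
have [s1|s1] := ltrP s 1.
  have r0 : 0 < 1 - s by rewrite subr_gt0.
  have rN : 1 - s != 0 by rewrite gt_eqF.
  have sN : sigma != 0 by rewrite gt_eqF.
  pose p := (1 - s)^-1 *: (y - s *: x).
  have Pp : P p.
    move=> j; rewrite dotZr mulrC ler_pdivrMr // !dotE.
    by have := fy j; rewrite /excess; lra.
  have -> : y = (1 - s / sigma) *: p + (s / sigma) *: (lambda *: p + sigma *: x).
    have yE : y = (1 - s) *: p + s *: x by rewrite scalerA divff // scale1r subrK.
    have lE : lambda = 1 - sigma by rewrite -ls addrK.
    rewrite [LHS]yE scalerDr !scalerA addrA -scalerDl divfK // lE.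
    by congr (_ *: _ + _); field; rewrite rN sN.
  apply: convex_hull_convex.
  - by rewrite divr_ge0 ?(ltW s0) //= ler_pdivrMr // mul1r.
  - by apply: sub_convex_hull; left.
  - by apply: sub_convex_hull; right; exists (lambda *: p) => //; exists p.
have sigma1 : sigma = 1 by lra.
have s11 : s = 1 by lra.
have lambda0 : lambda = 0 by lra.
apply: sub_convex_hull; right; exists (0 *: p0).
  by exists p0; [move=> i; exact: ltW | rewrite lambda0].
rewrite scale0r add0r sigma1 scale1r; apply/esym/eqP; rewrite -subr_eq0; apply/eqP.
apply: (recession_trivial bounded (fun i => ltW (p0P i))) => j.
by have := fy j; rewrite s11 /excess !dotE; lra.
Qed.

Lemma hull_level_not_homothetic lambda sigma mu c (z : 'rV[R]_3) :
  0 <= lambda -> 0 < sigma -> lambda + sigma = 1 -> 0 < mu -> vol3 P < c ->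
  (forall x, homothetic_hull_fun P lambda (sigma *: x) <= c <->
     exists2 p, P p & x = z + mu *: p) -> False.
Proof.
move=> l0 s0 ls mu0 cP level.
have s01 : 0 < sigma <= 1 by rewrite s0 /= -ls lerDr.
have qE' i : excess n h i (q i) = 0 by rewrite /excess qE subrr.
have q_lt' i j : j != i -> excess n h j (q i) < 0 by move=> ji; rewrite subr_lt0 q_lt.
have bounded' p : (forall i, excess n h i p <= 0) -> forall k, `|p 0 k| <= M.
  by move=> Pp; apply: bounded => i; rewrite -subr_le0; exact: Pp.
have p0P' i : excess n h i p0 <= 0 by rewrite subr_le0 ltW.
have [kap kap0 volE] := vol3_hull s01 qE' q_lt' bounded' p0P'.
apply: (level_set_not_homothetic (delta := c - vol3 P) qE q_lt bounded p0P kap0 mu0).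
  by rewrite subr_gt0.
move=> x; rewrite lerBrDl; have := level x.
rewrite /homothetic_hull_fun convex_hull_homothet // volE polytopeE; exact.
Qed.

End VolumeLevelSets.

Theorem theorem7 (R : realType) :
  (~ exists P : set 'rV[R]_3,
       [/\ convex_polytope P, interior P 0
         & exists lambda mu c : R,
             [/\ 0 <= lambda < 1, 0 < mu, vol3 P < c
               & scale mu P = sublevel_set (homothetic_hull_fun P lambda) c]])
  /\
  (~ exists P : set 'rV[R]_3,
       [/\ convex_polytope P, interior P !=set0
         & exists delta : R,
             0 < delta /\
             positive_homothetic_copy (illumination_body P delta) P]).
Proof.
split.
  case=> P [cP iP [lambda [mu [c [/andP[l0 l1] mu0 Pc level]]]]].
  have [N [n [h [q [M [PE qE q_lt bounded iP']]]]]] := polytope_facets cP iP.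
  have s0 : 0 < 1 - lambda by rewrite subr_gt0.
  have sN : 1 - lambda != 0 by rewrite gt_eqF.
  have lev t : homothetic_hull_fun P lambda t <= c <-> scale mu P t by rewrite level.
  rewrite PE in lev Pc.
  (* the copies are parametrized by their centers of homothety [t / (1 - lambda)] *)
  apply: (hull_level_not_homothetic (z := 0) qE q_lt bounded iP' l0 s0 (subrKC _ _)
    (divr_gt0 mu0 s0) Pc) => x.
  rewrite lev; split=> [[p Pp e]|[p Pp ->]]; exists p => //.
    by rewrite add0r mulrC -scalerA e scalerA mulVf // scale1r.
  by rewrite add0r scalerA mulrCA divff // mulr1.
case=> P [cP [p0 iP] [delta [delta0 [z [mu [mu0 level]]]]]].
have [N [n [h [q [M [PE qE q_lt bounded iP']]]]]] := polytope_facets cP iP.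
have Pp0 : P p0 by rewrite PE => i; exact: ltW.
have Pc : vol3 P < vol3 P + delta by rewrite ltrDl.
(* a point is a copy of [P] of ratio 0 *)
have one x : [set x] = translate (scale 0 P) (1 *: x).
  apply/seteqP; split=> y /=.
    by move=> ->; exists (0 *: p0); [exists p0 | rewrite scale0r add0r scale1r].
  by case=> _ [p _ <-] <-; rewrite scale0r add0r scale1r.
have key x : homothetic_hull_fun P 0 (1 *: x) <= vol3 P + delta <->
    exists2 p, P p & x = z + mu *: p.
  have lev : homothetic_hull_fun P 0 (1 *: x) <= vol3 P + delta <->
      translate (scale mu P) z x by rewrite -level /homothetic_hull_fun -one.
  rewrite lev.
  split=> [[_ [p Pp <-] <-]|[p Pp ->]].
    by exists p; rewrite // addrC.
  by exists (mu *: p); [exists p | rewrite addrC].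
rewrite PE in key Pc.
exact: (hull_level_not_homothetic qE q_lt bounded iP' (lexx 0) ltr01 (add0r 1) mu0 Pc key).
Qed.
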